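(* Let $\lambda$, $\mu$, $\nu$ be partitions of some nonnegative integer $m$. Let $p$, $q$, $r$ be positive integers such that $p\ge \ell(\lambda)$, $q\ge \ell(\mu)$, $r\ge \ell(\nu)$ and $p=qr$. Then for any positive integer $t$ we have \[ \mathsf{k}(\lambda,\mu,\nu) = \mathsf{k}\bigl(\lambda + (t)^p,\ \mu + (rt)^q,\ \nu + (qt)^r\bigr). \]
   Context: A partition is a vector $\lambda=(\lambda_1,\dots,\lambda_p)$ of nonnegative integers with $\lambda_1\ge\cdots\ge\lambda_p$; two partitions differing only by a string of zeros at the end are considered equal. The length $\ell(\lambda)$ is the number of positive parts of $\lambda$; $\lambda$ is a partition of $m$ if its parts sum to $m$. For partitions $\lambda,\mu,\nu$ of $m$, let $\chi^\lambda,\chi^\mu,\chi^\nu$ be the corresponding complex irreducible characters of the symmetric group $\mathsf{S}_m$. The Kronecker coefficient is $\mathsf{k}(\lambda,\mu,\nu):=\langle \chi^\lambda\otimes\chi^\mu,\chi^\nu\rangle$, the multiplicity of $\chi^\nu$ in the Kronecker product $\chi^\lambda\otimes\chi^\mu$ (the pointwise product of characters), where $\langle\cdot,\cdot\rangle$ is the inner product of complex characters of $\mathsf{S}_m$. For $m=0$, $\mathsf{S}_0$ is the trivial group, so $\mathsf{k}(\varnothing,\varnothing,\varnothing)=1$. For nonnegative integers $a$ and positive integers $n$, $(a)^n$ denotes the vector $(a,\dots,a)$ with $n$ entries. Sums such as $\lambda+(t)^p$ are sums of vectors, where $\lambda$ is regarded as a vector of $p$ entries by appending zeros (similarly $\mu$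 with $q$ entries and $\nu$ with $r$ entries). *)

(* Defs.v *)
From HB Require Import structures.
From mathcomp Require Import all_boot all_order all_algebra all_fingroup.
From mathcomp Require Import all_solvable all_field all_character.
Set Implicit Arguments.
Unset Strict Implicit.
Unset Printing Implicit Defensive.
Import GRing.Theory Num.Theory.

Local Open Scope nat_scope.

(* Trailing zeros are allowed; every notion below is insensitive to them. *)
Definition is_partition (m : nat) (la : seq nat) : bool :=
  sorted geq la && (sumn la == m).

Definition part_length (la : seq nat) : nat := count (fun x => 0 < x) la.

(* la + (a)^n, with la padded by zeros (or stripped of trailing zeros) to
   n entries; meaningful when part_length la <= n. *)
Definition add_const (la : seq nat) (a n : nat) : seq nat :=
  mkseq (fun i => nth 0 la i + a) n.

(* The Young diagram of a partition la of m is filled with 0, ..., m.-1 row by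
   row: the entry k lies in row reshape_index la k and in column
   reshape_offset la k. *)
Definition row_stab (m : nat) (la : seq nat) : {set 'S_m} :=
  [set s : 'S_m | [forall k, reshape_index la (s k) == reshape_index la k]].

Definition col_stab (m : nat) (la : seq nat) : {set 'S_m} :=
  [set s : 'S_m | [forall k, reshape_offset la (s k) == reshape_offset la k]].

Local Open Scope ring_scope.

(* The Young symmetrizer (\sum_r r) (\sum_c sgn(c) c), as an element of the
   group algebra of S_m, i.e. of the space of the regular representation. *)
Definition young_symmetrizer (m : nat) (la : seq nat) :
    'rV[algC]_#|[set: 'S_m]| :=
  \sum_(r in row_stab m la) \sum_(c in col_stab m la)
     (-1) ^+ c *: delta_mx 0 (gring_index [set: 'S_m] (r * c)%g).

(* The Specht module is the ideal generated by the Young symmetrizer. It is a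
   right ideal because MathComp representations act on row vectors on the
   right. *)
Definition specht_repr (m : nat) (la : seq nat) :=
  submod_repr (cyclic_mx_module (regular_repr algC [set: 'S_m])
                                (young_symmetrizer m la)).

(* chi^la, for la a partition of m. *)
Definition specht_char (m : nat) (la : seq nat) : 'CF([set: 'S_m]) :=
  cfRepr (specht_repr m la).

(* k(la, mu, nu), for la, mu, nu partitions of m. *)
Definition kronecker (m : nat) (la mu nu : seq nat) : algC :=
  '[specht_char m la * specht_char m mu, specht_char m nu].

(* Main.v *)
Require Import Defs.
From mathcomp Require Import all_boot all_order all_algebra all_fingroup.
From mathcomp Require Import all_solvable all_field all_character.
From mathcomp Require Import mpoly zify.

(* GL_q x GL_r acts on the tensor product of C^q and C^r, of dimension p = qr.
   The determinant of this representation is det^r (x) det^q, and tensoring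
   the Schur module of la with it gives the Schur module of la + (1)^p. This
   suggests the following argument with characters of symmetric groups.

   Let psi_g be the character of S_m on the words with g_j letters j. The
   weight multiplicity <chi^la, psi_g> is the dimension of the span of the
   polynomials
     D_la(u) = product over the columns j of la of the minor of the matrix
               (z_ab) with rows 1, ..., la'_j and with columns given by the
               letters of u in column j,
   where u ranges over the fillings of la of content g. When the letters
   are 1, ..., p and la has at most p rows, a filling of la + (1)^p gives the
   polynomial of a filling of la times +-det(z), or 0. Multiplication by det(z)
   is injective, so <chi^(la+t^p), psi_(g+t)> = <chi^la, psi_g>, while
   <chi^(la+t^p), psi_g> = 0 if some g_j < t.

   As D_la(u) = 0 unless the letters in each column of u are distinct,
   <chi^la, psi_g> is unitriangular for the dominance order. This implies that
   chi^la is irreducible, and since the psi_g span the class functions, all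
   the irreducible characters are of this form. The product psi_a psi_b is the
   sum of the psi_c over the q x r matrices c with margins a and b, which gives
   <chi^la psi_a, psi_b> = <chi^(la+t^p) psi_(a+rt), psi_(b+qt)>, and
   <chi^(la+t^p) psi_a, psi_b> = 0 if some a_i < rt or some b_j < qt.
   Unitriangularity converts this into the equality of Kronecker
   coefficients. *)

Set Implicit Arguments.
Unset Strict Implicit.
Unset Printing Implicit Defensive.
Import Order.TTheory GRing.Theory Num.Theory.

Local Open Scope ring_scope.

(** * Words and permutation characters *)

Section Words.
Variables (m : nat) (T : eqType).
Implicit Types (w : 'I_m -> T) (s : 'S_m).

Definition word_stab w : {set 'S_m} := [set s : 'S_m | [forall k, w (s k) == w k]].

Definition content w (t : T) : nat := #|[pred k | w k == t]|.

Lemma word_stabP w s : reflect (forall k, w (s k) = w k) (s \in word_stab w).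
Proof. by rewrite inE; apply: (iffP forallP) => H k; apply/eqP. Qed.

Lemma word_stab_group_set w : group_set (word_stab w).
Proof.
apply/group_setP; split=> [|x y /word_stabP wx /word_stabP wy].
  by apply/word_stabP=> k; rewrite perm1.
by apply/word_stabP=> k; rewrite permM wy wx.
Qed.
Canonical word_stab_group w := Group (word_stab_group_set w).

Lemma content_perm w s : content (fun k => w (s k)) =1 content w.
Proof.
move=> t; rewrite /content -!sum1_card [RHS](reindex_inj (@perm_inj _ s)) /=.
by apply: eq_bigl => k; rewrite !inE.
Qed.

Lemma eq_content w1 w2 : w1 =1 w2 -> content w1 =1 content w2.
Proof. by move=> eqw t; apply: eq_card => k; rewrite !inE eqw. Qed.

Lemma same_content w1 w2 :
  content w1 =1 content w2 -> exists s : 'S_m, forall k, w2 k = w1 (s k).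
Proof.
move=> eqc.
have countE w t : count_mem t (mktuple w) = content w t.
  rewrite /= count_map /content cardE size_filter enumT.
  by apply: eq_count => k; rewrite !inE.
have /tuple_permP [s Es] : perm_eq (mktuple w2) (mktuple w1).
  by apply/allP=> t _; rewrite /= -[map w2 _]/(val (mktuple w2)) !countE eqc.
exists s => k; have /val_inj/(congr1 (fun t : m.-tuple T => tnth t k)) := Es.
by rewrite !tnth_mktuple.
Qed.
End Words.

Section Psi.
Variables (m n : nat).
Implicit Types (w : {ffun 'I_m -> 'I_n}) (s : 'S_m) (g : 'I_n -> nat).
Local Notation G := [set: 'S_m].

Definition word_act w s : {ffun 'I_m -> 'I_n} := [ffun k => w (s k)].

Lemma word_actM w s t : word_act w (s * t)%g = word_act (word_act w t) s.
Proof. by apply/ffunP=> k; rewrite !ffunE permM. Qed.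

Lemma word_act1 w : word_act w 1%g = w.
Proof. by apply/ffunP=> k; rewrite !ffunE perm1. Qed.

Lemma word_stab_act w s : s \in word_stab w = (word_act w s == w).
Proof.
apply/word_stabP/eqP => [H | /ffunP H k]; last by have := H k; rewrite !ffunE.
by apply/ffunP=> k; rewrite ffunE.
Qed.

Lemma word_stabJ w s x : (x \in word_stab (word_act w s)) = (x ^ s \in word_stab w)%g.
Proof.
apply/word_stabP/word_stabP => H k.
  by have:= H (s^-1 k)%g; rewrite !ffunE permKV conjgE !permM.
by have := H (s k)%g; rewrite !ffunE conjgE !permM permK.
Qed.

Definition word_set g : {set {ffun 'I_m -> 'I_n}} :=
  [set w : {ffun 'I_m -> 'I_n} | [forall j, content w j == g j]].

Lemma word_setP g w : reflect (content w =1 g) (w \in word_set g).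
Proof. by rewrite inE; apply: (iffP forallP) => H k; apply/eqP. Qed.

Lemma word_set_act g w s : (word_act w s \in word_set g) = (w \in word_set g).
Proof.
by apply/word_setP/word_setP=> H k; rewrite -H -(content_perm w s k);
  apply: eq_content => i; rewrite ffunE.
Qed.

Definition psi_val g s : algC := #|[set w in word_set g | s \in word_stab w]|%:R.

Lemma psi_subproof g : is_class_fun <<G>>%G [ffun s => psi_val g s].
Proof.
apply: intro_class_fun => [x y _ _ | x]; last by case/negP; rewrite mem_gen ?inE.
congr (_%:R); rewrite -[RHS](@on_card_preimset _ _ (fun w => word_act w y)).
  by apply: eq_card => w;
    rewrite in_set [RHS]in_set [RHS]in_set word_stabJ word_set_act.
apply: onW_bij; exists (fun w => word_act w y^-1%g) => w; rewrite -word_actM.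
  by rewrite mulVg word_act1.
by rewrite mulgV word_act1.
Qed.

Definition psi g : 'CF(G) := Cfun 1 (psi_subproof g).

Lemma psiE g s : psi g s = #|[set w in word_set g | s \in word_stab w]|%:R.
Proof. by rewrite cfunElock. Qed.

Lemma eq_psi g g' : g =1 g' -> psi g = psi g'.
Proof.
move=> E; apply/cfunP=> s; rewrite !psiE; congr (_%:R); apply: eq_card => w.
by rewrite !in_set; congr andb; apply: eq_forallb => j; rewrite E.
Qed.

Lemma psi_sum g s : psi g s = \sum_(w in word_set g) (s \in word_stab w)%:R.
Proof.
rewrite psiE -sum1_card natr_sum big_mkcond [RHS]big_mkcond /=.
by apply: eq_bigr => w _; rewrite in_set; case: (w \in _); case: (s \in _).
Qed.

Lemma conj_psi g s : (psi g s)^* = psi g s.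
Proof. by rewrite psiE conjC_nat. Qed.

Lemma cfdot_psi_words (phi : 'CF(G)) g :
  '[phi, psi g] = #|G|%:R^-1 *
     \sum_(w in word_set g) \sum_(s in word_stab w) phi s.
Proof.
rewrite cfdotE; congr (_ * _).
transitivity (\sum_(s in G) \sum_(w in word_set g) phi s *+ (s \in word_stab w)).
  apply: eq_bigr => s _; rewrite conj_psi psi_sum mulr_sumr.
  by apply: eq_bigr => w _; rewrite mulr_natr.
rewrite exchange_big; apply: eq_bigr => w _; rewrite [RHS]big_mkcond /=.
by apply: eq_big => s; [rewrite in_setT | rewrite mulrb].
Qed.

Lemma cfdot_psi_eq0 (phi : 'CF(G)) g :
  (forall w, ~ content w =1 g) -> '[phi, psi g] = 0.
Proof.
move=> Ng; rewrite cfdot_psi_words big1 ?mulr0 // => w /word_setP wg.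
by case: (Ng w).
Qed.

(** This is Frobenius reciprocity: the words of content [g] form one orbit, so [psi g] is induced
    from the trivial character of [word_stab w]. By conjugation, the inner sum in [cfdot_psi_words]
    is the same for all words of the orbit. *)
Lemma cfdot_psi (phi : 'CF(G)) g w : content w =1 g ->
  '[phi, psi g] = #|word_stab w|%:R^-1 * \sum_(s in word_stab w) phi s.
Proof.
move=> wg; pose F (u : {ffun 'I_m -> 'I_n}) := \sum_(s in word_stab u) phi s.
have FJ s : F (word_act w s) = F w.
  rewrite /F [RHS](reindex_inj (@conjg_inj _ s)) /=.
  by apply: eq_big => x; rewrite ?word_stabJ // cfunJ ?inE.
have cardF u : u \in word_set g ->
    #|[set s | word_act w s == u]| = #|word_stab w|.
  move=> /word_setP ug.
  have [s0 Es0] : exists s : 'S_m, forall k, u k = w (s k).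
    by apply: same_content => j; rewrite wg ug.
  have{Es0} <- : word_act w s0 = u by apply/ffunP=> k; rewrite ffunE Es0.
  rewrite -(card_lcoset (word_stab w) s0); apply: eq_card => s.
  rewrite mem_lcoset in_set word_stab_act word_actM /=; apply/eqP/eqP => [-> | Ew].
    by rewrite -word_actM mulVg word_act1.
  by rewrite -[word_act w s]word_act1 -(mulgV s0) word_actM Ew.
have cardH : #|word_stab w|%:R != 0 :> algC by rewrite (neq0CG (word_stab_group w)).
rewrite cfdot_psi_words -[LHS](mulKf cardH); congr (_ * _).
rewrite mulrCA mulr_sumr.
transitivity (#|G|%:R^-1 * \sum_(s in G) F (word_act w s)).
  congr (_ * _); rewrite (partition_big (word_act w) (mem (word_set g))) => [|s _].
    apply: eq_bigr => u ug; rewrite -(cardF u ug).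
    rewrite (eq_bigr (fun=> F u)) => [|s /andP[_ /eqP-> //]].
    rewrite sumr_const mulr_natl; congr (_ *+ _).
    by apply: eq_card => s; rewrite [RHS]unfold_in /= in_setT in_set.
  by rewrite /= word_set_act; apply/word_setP.
rewrite (eq_bigr (fun=> F w)) // sumr_const -(mulr_natl (F w)) mulKf //.
exact: neq0CG.
Qed.
End Psi.

(** * Rank of a finite family of polynomials *)

Section PolyRank.
Variable N : nat.
Local Notation P := {mpoly algC[N]}.

Lemma eq_rank_ker p n1 n2 (A : 'M[algC]_(p, n1)) (B : 'M[algC]_(p, n2)) :
  (forall x : 'rV_p, x *m A = 0 <-> x *m B = 0) -> \rank A = \rank B.
Proof.
move=> AB; have eqK : (kermx A == kermx B)%MS.
  by apply/andP; split; apply/row_subP=> i; apply/sub_kermxP; apply/AB;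
     apply/sub_kermxP; apply: row_sub.
have := mxrank_ker A; rewrite (eqmxP eqK) mxrank_ker => /eqP.
by rewrite eqn_sub2lE ?rank_leq_row // => /eqP.
Qed.

(** Keeping only the monomials of degree below [b] makes the matrix finite; no coefficient is lost
    once [b] bounds every [msize (F i)]. *)
Definition coefmx b (I : finType) (F : I -> P) :
    'M[algC]_(#|I|, #|{: 'X_{1..N < b}}|) :=
  \matrix_(i, j) (F (enum_val i))@_(val (enum_val j)).

Lemma coefmxP b (I : finType) (F : I -> P) (x : 'rV_#|I|) :
    (forall i, msize (F i) <= b)%N ->
  x *m coefmx b F = 0 <-> \sum_k x 0 k *: F (enum_val k) = 0.
Proof.
move=> Fb; set S := \sum_k _.
have E j : (x *m coefmx b F) 0 j = S@_(val (enum_val j)).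
  rewrite mxE raddf_sum; apply: eq_bigr => k _.
  by rewrite mxE [RHS]mcoeffZ.
split=> [x0 | S0]; last by apply/rowP=> j; rewrite E S0 mcoeff0 mxE.
apply/mpolyP=> mn; rewrite mcoeff0.
have [mb | bm] := ltnP (mdeg mn) b.
  by have := E (enum_rank (BMultinom mb)); rewrite x0 enum_rankK mxE.
rewrite raddf_sum big1 // => k _; rewrite /= mcoeffZ; apply/eqP.
rewrite mulf_eq0 mcoeff_eq0 msize_mdeg_ge ?orbT //.
exact: leq_trans (Fb _) bm.
Qed.

Definition poly_rank (I : finType) (F : I -> P) : nat :=
  \rank (coefmx (\max_i msize (F i)) F).

(** The rank depends only on the left kernel. This allows averages in the group algebra to be
    compared with bideterminants through their linear relations alone. *)
Lemma poly_rankE (I : finType) (F : I -> P) n (A : 'M[algC]_(#|I|, n)) :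
  (forall x : 'rV_#|I|, x *m A = 0 <-> \sum_k x 0 k *: F (enum_val k) = 0) ->
  \rank A = poly_rank F.
Proof.
move=> AF; apply: eq_rank_ker => x; rewrite AF.
by rewrite -(coefmxP (b := \max_i msize (F i))) // => i; apply: leq_bigmax.
Qed.

Lemma poly_rank_coefmx b (I : finType) (F : I -> P) :
  (forall i, msize (F i) <= b)%N -> poly_rank F = \rank (coefmx b F).
Proof. by move=> Fb; rewrite (@poly_rankE _ F) // => x; apply: coefmxP. Qed.

Lemma poly_rank_mull (I : finType) (F : I -> P) d :
  d != 0 -> poly_rank (fun i => d * F i) = poly_rank F.
Proof.
move=> d0; apply: poly_rankE => x; rewrite coefmxP => [|i]; last first.
  exact: (leq_bigmax (F := fun i => msize (d * F i))).
rewrite (eq_bigr (fun k => d * (x 0 k *: F (enum_val k)))); last first.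
  by move=> k _; rewrite -scalerAr.
rewrite -mulr_sumr; split=> [/eqP | ->]; last by rewrite mulr0.
by rewrite mulf_eq0 (negPf d0) => /eqP.
Qed.

Lemma poly_rank_sub (I J : finType) (F : I -> P) (F' : J -> P) :
    (forall i, F i = 0 \/ exists c j, F i = c *: F' j) ->
  (poly_rank F <= poly_rank F')%N.
Proof.
move=> FF'; pose b := maxn (\max_i msize (F i)) (\max_j msize (F' j)).
rewrite !(@poly_rank_coefmx b); first 1 last.
- by move=> j; rewrite leq_max (leq_bigmax (F := fun j => msize (F' j))) orbT.
- by move=> i; rewrite leq_max (leq_bigmax (F := fun i => msize (F i))).
apply/mxrankS/row_subP=> i.
have [F0 | [c [j Fj]]] := FF' (enum_val i).
  by have->: row i (coefmx b F) = 0 :> 'rV__;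
    [apply/rowP=> k; rewrite !mxE F0 mcoeff0 | apply: sub0mx].
have->: row i (coefmx b F) = c *: row (enum_rank j) (coefmx b F').
  by apply/rowP=> k; rewrite !mxE Fj enum_rankK mcoeffZ.
by rewrite scalemx_sub ?row_sub.
Qed.

Lemma poly_rank_eq0 (I : finType) (F : I -> P) :
  (forall i, F i = 0) -> poly_rank F = 0%N.
Proof.
move=> F0; apply/eqP; rewrite mxrank_eq0; apply/eqP/matrixP=> i j.
by rewrite !mxE F0 mcoeff0.
Qed.

Lemma poly_rank_neq0 (I : finType) (F : I -> P) :
  poly_rank F != 0%N -> exists i, F i != 0.
Proof.
move=> r0; apply/existsP; apply: contraNT r0 => /existsPn F0.
by apply/eqP/poly_rank_eq0 => i; apply/eqP/negbNE.
Qed.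

Lemma poly_rank_line (I : finType) (F : I -> P) i0 :
    F i0 != 0 -> (forall i, exists c, F i = c *: F i0) -> poly_rank F = 1%N.
Proof.
move=> F0 FF0; apply/eqP; rewrite eqn_leq; apply/andP; split.
  have /leq_trans-> // : (poly_rank F <= poly_rank (fun _ : unit => F i0))%N.
    apply: poly_rank_sub => i; right; have [c Fi] := FF0 i.
    by exists c, tt.
  by apply: leq_trans (rank_leq_row _) _; rewrite card_unit.
rewrite lt0n; apply: contraNneq F0 => /eqP; rewrite mxrank_eq0 => /eqP M0.
pose x : 'rV[algC]_#|I| := delta_mx 0 (enum_rank i0).
have /(coefmxP x) [+ _] : forall i, (msize (F i) <= \max_i msize (F i))%N.
  by move=> i; apply: leq_bigmax.
rewrite M0 mulmx0 => /(_ erefl); rewrite (bigD1 (enum_rank i0)) //= big1.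
  by rewrite addr0 mxE !eqxx scale1r enum_rankK => ->.
by move=> k nk; rewrite mxE (negPf nk) andbF scale0r.
Qed.
End PolyRank.

(** * Bideterminants *)

Section Bideterminants.
Variables l n : nat.
Local Notation P := {mpoly algC[l * n]}.

Definition zvar (i : 'I_l) (j : 'I_n) : P := 'X_(mxvec_index i j).

(* Grouping the cells by columns makes this matrix block diagonal, so that its
   determinant is the product over the columns of minors of the generic matrix
   (zvar i j). *)
Definition bidet_mx m (rw : 'I_m -> 'I_l) (cl : 'I_m -> nat) (u : 'I_m -> 'I_n) :
    'M[P]_m :=
  \matrix_(x, y) (if cl x == cl y then zvar (rw x) (u y) else 0).

Definition bidet m rw cl u : P := \det (@bidet_mx m rw cl u).

Lemma eq_bidet m (rw rw' : 'I_m -> 'I_l) (cl cl' : 'I_m -> nat) (u u' : 'I_m -> 'I_n) :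
  rw =1 rw' -> cl =1 cl' -> u =1 u' -> bidet rw cl u = bidet rw' cl' u'.
Proof.
by move=> E1 E2 E3; congr (\det _); apply/matrixP=> x y; rewrite !mxE E1 !E2 E3.
Qed.

Variables (m : nat) (rw : 'I_m -> 'I_l) (cl : 'I_m -> nat).
Implicit Types (u : 'I_m -> 'I_n).

(** The exponent at [(i, j)] counts the letters [j] in row [i], so this monomial is the
    row-equivalence class (tabloid) of the filling [u]. *)
Definition bimon u : 'X_{1..l * n} :=
  (\sum_k U_(mxvec_index (rw k) (u k)))%MM.

Lemma bimonE u i : bimon u i = content (fun k => mxvec_index (rw k) (u k)) i.
Proof.
rewrite /bimon mnm_sumE /content -sum1_card [RHS]big_mkcond /=.
by apply: eq_bigr => k _; rewrite mnm1E unfold_in; case: (_ == _).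
Qed.

Lemma mxvec_index_inj (i i' : 'I_l) (j j' : 'I_n) :
  mxvec_index i j = mxvec_index i' j' -> i = i' /\ j = j'.
Proof.
pose inj := bij_inj (onT_bij (curry_mxvec_bij l n)).
by move/(inj (i, j) (i', j')) => [-> ->].
Qed.

Lemma bimonP u u' : bimon u = bimon u' <->
  exists s : 'S_m, s \in word_stab rw /\ forall k, u' k = u (s k).
Proof.
split=> [/mnmP E | [s [/word_stabP rs us]]].
  have [i|s Es] := @same_content m _ (fun k => mxvec_index (rw k) (u k))
                                     (fun k => mxvec_index (rw k) (u' k)).
    by rewrite -!bimonE E.
  exists s; split; last by move=> k; have [] := mxvec_index_inj (Es k).
  by apply/word_stabP => k; have [-> _] := mxvec_index_inj (Es k).
apply/mnmP=> i; rewrite !bimonE -(content_perm _ s).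
by apply: eq_content => k; rewrite rs us.
Qed.

(** In the Leibniz formula, a permutation that moves some cell to another column meets a zero
    entry. *)
Lemma bidetE u :
  bidet rw cl u = \sum_(c in word_stab cl) (-1) ^+ c *: 'X_[bimon (fun k => u (c k))].
Proof.
rewrite /bidet /determinant [RHS]big_mkcond /=; apply: eq_bigr => c _.
case: (boolP (c \in _)) => [/word_stabP cc | /word_stabP cc].
  rewrite /bimon -mprodXE scaler_sign -mulr_sign; congr (_ * _).
  by apply: eq_bigr => k _; rewrite mxE cc eqxx.
have /existsP[k ck] : [exists k, cl (c k) != cl k].
  by apply: contraT => /existsPn H; case: cc => k; apply/eqP/negbNE.
by rewrite (bigD1 k) //= mxE eq_sym (negPf ck) mul0r mulr0.
Qed.

Lemma bidet_perm u s : s \in word_stab cl ->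
  bidet rw cl (fun k => u (s k)) = (-1) ^+ s * bidet rw cl u.
Proof.
move/word_stabP=> cs; rewrite /bidet.
have->: bidet_mx rw cl (fun k => u (s k)) = col_perm s (bidet_mx rw cl u).
  by apply/matrixP=> x y; rewrite !mxE cs.
by rewrite col_permE det_mulmx det_perm odd_permV mulrC.
Qed.

Lemma bidet_inj u x y :
  bidet rw cl u != 0 -> cl x = cl y -> u x = u y -> x = y.
Proof.
move=> nz cxy uxy; apply: contraNeq nz => nxy; rewrite /bidet -det_tr.
apply/eqP/(determinant_alternate nxy) => z.
by rewrite !mxE cxy uxy.
Qed.
End Bideterminants.

(** When the identity matrix is substituted for the generic one, [bidet_mx] becomes the identity,
    because a cell is determined by its row and column. *)
Lemma bidet_diag_neq0 n m (rw : 'I_m -> 'I_n) (cl : 'I_m -> nat) :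
    (forall x y, rw x = rw y -> cl x = cl y -> x = y) ->
  bidet rw cl rw != 0.
Proof.
move=> rcI; pose v k : algC := mxvec (1%:M : 'M_n) 0 k.
have: (bidet rw cl rw).@[v] != 0.
  rewrite /bidet -det_map_mx.
  have->: map_mx (meval v) (bidet_mx rw cl rw) = 1%:M;
    last by rewrite det1 oner_neq0.
  apply/matrixP=> x y; rewrite !mxE; have [<- | nxy] := eqVneq x y.
    by rewrite eqxx mevalXU /v mxvecE mxE eqxx.
  case: eqP => [cxy | _]; last exact: meval0.
  rewrite mevalXU /v mxvecE mxE; case: eqP => // rxy.
  by rewrite (rcI x y) ?eqxx in nxy.
by apply: contraNneq => ->; rewrite meval0.
Qed.

(** * A full column multiplies bideterminants by det(z) *)

Section Shift.
Variables (p m m' : nat) (rw : 'I_m -> 'I_p) (cl : 'I_m -> nat).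
Variables (rw' : 'I_m' -> 'I_p) (cl' : 'I_m' -> nat).
Variable e : 'I_(p + m) -> 'I_m'.
Hypotheses (Em : m' = (p + m)%N) (eI : injective e).
Hypotheses (rwl : forall i, rw' (e (lshift m i)) = i).
Hypotheses (cll : forall i, cl' (e (lshift m i)) = 0%N).
Hypotheses (rwr : forall k, rw' (e (rshift p k)) = rw k).
Hypotheses (clr : forall k, cl' (e (rshift p k)) = (cl k).+1).

Let detz : {mpoly algC[p * p]} := \det (\matrix_(i, j) zvar i j).

Lemma det_reindex (R : comPzRingType) (B : 'M[R]_m') :
  \det (\matrix_(x, y) B (e x) (e y)) = \det B.
Proof.
move: e eI B; rewrite Em => f fI B.
have->: \matrix_(x, y) B (f x) (f y) = row_perm (perm fI) (col_perm (perm fI) B).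
  by apply/matrixP=> x y; rewrite !mxE !permE.
rewrite row_permE col_permE !det_mulmx !det_perm odd_permV mulrC -mulrA.
by rewrite -signr_addb addbb mulr1.
Qed.

(** The map [e] lists the larger diagram as a new column 0 of [p] cells, one in each row, followed
    by the old cells moved one column to the right. The two groups share no column, so the matrix is
    block diagonal. *)
Lemma bidet_split (u : 'I_m' -> 'I_p) :
  bidet rw' cl' u = \det (\matrix_(i, j) zvar i (u (e (lshift m j)))) *
                    bidet rw cl (fun k => u (e (rshift p k))).
Proof.
rewrite /bidet -det_reindex -(det_ublock _ 0); congr (\det _).
apply/matrixP=> x y; rewrite mxE.
case: (split_ordP x) => i ->; case: (split_ordP y) => j ->.
- by rewrite block_mxEul !mxE !cll rwl.
- by rewrite block_mxEur !mxE cll clr.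
- by rewrite block_mxEdl !mxE cll clr.
- by rewrite block_mxEdr !mxE !clr rwr eqSS.
Qed.

Lemma det_zvar_inj (v : 'I_p -> 'I_p) (vI : injective v) :
  \det (\matrix_(i, j) zvar i (v j)) = (-1) ^+ perm vI * detz.
Proof.
have->: \matrix_(i < p, j < p) zvar i (v j) =
    col_perm (perm vI) (\matrix_(i < p, j < p) zvar i j).
  by apply/matrixP=> x y; rewrite !mxE !permE.
by rewrite col_permE det_mulmx det_perm odd_permV mulrC.
Qed.

Lemma det_zvar_eq0 (v : 'I_p -> 'I_p) :
  ~~ injectiveb v -> \det (\matrix_(i, j) zvar i (v j)) = 0.
Proof.
move=> /injectivePn [i [j nij vij]].
by rewrite -det_tr; apply: (determinant_alternate nij) => k; rewrite !mxE vij.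
Qed.

Lemma detz_neq0 : detz != 0.
Proof.
have := @bidet_diag_neq0 p p id (fun=> 0%N) (fun x y E _ => E).
by congr (\det _ != 0); apply/matrixP=> x y; rewrite !mxE.
Qed.

Lemma content_split (u : 'I_m' -> 'I_p) j :
  content u j = (content (fun i => u (e (lshift m i))) j +
                 content (fun k => u (e (rshift p k))) j)%N.
Proof.
have eB : bijective e by apply: inj_card_bij; rewrite ?card_ord ?Em.
have cE T (w : 'I_T -> 'I_p) : content w j = (\sum_k (w k == j))%N.
  rewrite /content -sum1_card big_mkcond /=.
  by apply: eq_bigr => k _; rewrite unfold_in; case: (_ == _).
rewrite !cE (reindex e) /=; last exact: onW_bij.
by rewrite big_split_ord.
Qed.

Lemma content_inj1 (v : 'I_p -> 'I_p) j : injective v -> content v j = 1%N.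
Proof.
move=> vI; have [v' vK v'K] := injF_bij vI.
rewrite /content (@eq_card1 _ (v' j)) // => i.
by rewrite !inE; apply/eqP/eqP => [<- | ->].
Qed.

Variables (w : 'I_m -> 'I_p) (w' : 'I_m' -> 'I_p).

(** A nonzero bideterminant needs [p] distinct letters in column 0, that is, all of them; here the
    letter [j] never occurs. *)
Lemma poly_rank_shift0 j : content w' j = 0%N ->
  poly_rank (fun g : 'S_m' => bidet rw' cl' (fun k => w' (g k))) = 0%N.
Proof.
move=> w'j; apply: poly_rank_eq0 => g; rewrite bidet_split.
case: (boolP (injectiveb (fun i => w' (g (e (lshift m i)))))) => [/injectiveP vI | vN].
  2: by rewrite det_zvar_eq0 ?mul0r.
have := content_split (fun k => w' (g k)) j.
by rewrite content_perm w'j content_inj1.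
Qed.

(** A larger filling with distinct letters in column 0 gives, up to sign, [detz] times a smaller
    bideterminant, and any other gives 0. Conversely, every smaller filling extends. As [detz] is
    nonzero, the ranks agree. *)
Lemma poly_rank_shift : (forall j, content w' j = (content w j).+1) ->
  poly_rank (fun g : 'S_m' => bidet rw' cl' (fun k => w' (g k))) =
  poly_rank (fun g : 'S_m => bidet rw cl (fun k => w (g k))).
Proof.
move=> ww'; rewrite -[RHS](poly_rank_mull _ detz_neq0).
apply/eqP; rewrite eqn_leq; apply/andP; split; apply: poly_rank_sub.
  move=> g; rewrite bidet_split.
  case: (boolP (injectiveb (fun i => w' (g (e (lshift m i)))))) => [/injectiveP vI | vN].
    2: by left; rewrite det_zvar_eq0 ?mul0r.
  rewrite (det_zvar_inj vI); right.
  have [j|s Es] := @same_content m _ w (fun k => w' (g (e (rshift p k)))).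
    have := content_split (fun k => w' (g k)) j.
    by rewrite content_perm ww' content_inj1 // => -[].
  exists ((-1) ^+ perm vI), s.
  rewrite (eq_bidet (fun=> erefl) (fun=> erefl) Es).
  by rewrite -mulrA mulr_sign scaler_sign.
have eB : bijective e by apply: inj_card_bij; rewrite ?card_ord ?Em.
have [e' eK e'K] := eB.
move=> g; right.
(* The smaller filling is extended by the letter [i] in row [i] of column 0, which makes the new
   minor exactly [detz]. *)
pose u x := match split (e' x) with inl i => i | inr k => w (g k) end.
have ul i : u (e (lshift m i)) = i by rewrite /u eK (unsplitK (inl i)).
have ur k : u (e (rshift p k)) = w (g k) by rewrite /u eK (unsplitK (inr k)).
have [j | s Es] := @same_content m' _ w' u.
  rewrite [RHS]content_split (eq_content ul) (eq_content ur) content_perm ww'.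
  by rewrite content_inj1.
exists 1, s; rewrite scale1r.
rewrite -(eq_bidet (fun=> erefl) (fun=> erefl) Es) bidet_split.
congr (_ * _); first by congr (\det _); apply/matrixP=> i j; rewrite !mxE ul.
by apply: eq_bidet.
Qed.
End Shift.

(** * Weight multiplicities of Specht modules *)

Section FixedSpaceDimension.
Variables (gT : finGroupType) (G H : {group gT}) (n : nat).
Variable rG : mx_representation algC G n.
Hypothesis sHG : H \subset G.

Lemma mxtrace_idem k (A : 'M[algC]_k) : A *m A = A -> \tr A = (\rank A)%:R.
Proof.
move=> AA; move: (col_base_full A) (row_base_free A) (mulmx_base A).
move: (col_base A) (row_base A) => C R Cfull Rfree CR.
rewrite -{1}CR mxtrace_mulC; suff ->: R *m C = 1%:M by rewrite mxtrace1.
apply: (row_full_inj Cfull); apply: (row_free_inj Rfree) => /=.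
by rewrite mulmx1 mulmxA CR -mulmxA CR.
Qed.

Definition avg_mx : 'M[algC]_n := #|H|%:R^-1 *: \sum_(h in H) rG h.

Lemma repr_avg_mx x : x \in H -> rG x *m avg_mx = avg_mx.
Proof.
move=> Hx; rewrite -scalemxAr mulmx_sumr; congr (_ *: _).
rewrite [RHS](reindex_inj (mulgI x)) /=; apply: eq_big => h;
  first by rewrite groupMl.
by move=> Hh; rewrite repr_mxM ?(subsetP sHG).
Qed.

Lemma avg_mx_idem : avg_mx *m avg_mx = avg_mx.
Proof.
rewrite {1}/avg_mx -scalemxAl mulmx_suml.
rewrite (eq_bigr (fun=> avg_mx)) => [|h Hh]; last exact: repr_avg_mx.
by rewrite sumr_const -scaler_nat scalerA mulVf ?scale1r ?neq0CG.
Qed.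

(** The matrix [avg_mx] projects onto the [H]-invariants, and the trace of an idempotent is its
    rank; [T] is this projection restricted to [U]. *)
Lemma cfRepr_avg (U : 'M[algC]_n) (modU : mxmodule rG U) :
  #|H|%:R^-1 * \sum_(h in H) cfRepr (submod_repr modU) h =
    (\rank (U *m avg_mx))%:R.
Proof.
pose T : 'M_(\rank U) := in_submod U (val_submod 1%:M *m avg_mx).
have UE : (val_submod (1%:M : 'M_(\rank U)) *m avg_mx <= U)%MS.
  rewrite -scalemxAr scalemx_sub // mulmx_sumr summx_sub // => h Hh.
  by rewrite mxmodule_trans ?val_submodP ?(subsetP sHG).
have valT : val_submod T = val_submod 1%:M *m avg_mx by rewrite in_submodK.
have TT : T *m T = T.
  apply: val_submod_inj; rewrite valT {1}/val_submod /= -mulmxA.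
  rewrite -[T *m row_base U]/(val_submod T) valT mulmxA -val_submodE valT.
  by rewrite -mulmxA avg_mx_idem.
transitivity (\tr T).
  rewrite /T /avg_mx -scalemxAr linearZ /= mxtraceZ mulmx_sumr !linear_sum /=.
  congr (_ * _); apply: eq_bigr => h Hh.
  by rewrite cfunE (subsetP sHG) // mulr1n.
rewrite mxtrace_idem // mxrank_in_submod //; congr (_%:R).
by rewrite (eqmxMr avg_mx (val_submod1 U)).
Qed.
End FixedSpaceDimension.

(** * Invariants of Specht modules as bideterminants *)

Section SpechtRank.
Variables (m : nat) (la : seq nat).
Local Notation G := [set: 'S_m].
Local Notation aG := (regular_repr algC G).
Local Notation dl x := (delta_mx 0 (gring_index G x) : 'rV[algC]_#|G|).
Local Notation ys := (young_symmetrizer m la).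
Local Notation U := (cyclic_mx aG ys).

Lemma delta_regular x g : dl x *m aG g = dl (x * g)%g.
Proof. by rewrite -rowE rowK gring_indexK ?inE. Qed.

Lemma delta_coef x y : dl x 0 (gring_index G y) = (x == y)%:R.
Proof.
rewrite mxE eqxx; congr ((nat_of_bool _)%:R).
apply/eqP/eqP => [E | -> //].
by rewrite -[x](@gring_indexK _ G) ?inE // -E gring_indexK ?inE.
Qed.

Lemma young_regular g : ys *m aG g =
  \sum_(r in row_stab m la) \sum_(c in col_stab m la) (-1) ^+ c *: dl (r * c * g)%g.
Proof.
rewrite mulmx_suml; apply: eq_bigr => r _; rewrite mulmx_suml.
by apply: eq_bigr => c _; rewrite -scalemxAl delta_regular.
Qed.

Definition young_mx : 'M[algC]_(#|'S_m|, #|G|) := \matrix_i (ys *m aG (enum_val i)).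

Lemma young_mxE : (U :=: young_mx)%MS.
Proof.
apply/eqmxP/andP; split.
  apply: cyclic_mx_sub.
    apply/mxmoduleP=> x Gx; apply/row_subP=> i.
    rewrite row_mul rowK -mulmxA -repr_mxM ?inE //.
    by have := row_sub (enum_rank (enum_val i * x)%g) young_mx;
      rewrite rowK enum_rankK.
  have := row_sub (enum_rank (1%g : 'S_m)) young_mx.
  by rewrite rowK enum_rankK repr_mx1 mulmx1.
apply/row_subP=> i; rewrite rowK.
by rewrite mxmodule_trans ?cyclic_mx_module ?cyclic_mx_id ?inE.
Qed.

Section Fixed.
Variables (l n : nat) (rw : 'I_m -> 'I_l) (w : 'I_m -> 'I_n).
Hypothesis rwE : forall k, rw k = reshape_index la k :> nat.
Local Notation cl := (fun k : 'I_m => reshape_offset la k).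
Local Notation H := (word_stab_group w).
Local Notation R := (word_stab_group rw).
Local Notation mon z := (bimon rw (fun k => w ((z : 'S_m) k))).

Lemma row_stabE : row_stab m la = word_stab rw.
Proof.
apply/setP=> s; rewrite !inE; apply: eq_forallb => k.
by rewrite -!rwE (inj_eq val_inj).
Qed.

(* The coset x H is the word w \o x, and the double coset R x H is the monomial
   mon x: averaging over R and H on both sides identifies the vectors of the
   Specht module fixed by H with combinations of bideterminants. *)
Definition dcoset_count z y : nat :=
  \sum_(r in R) \sum_(h in H) ((r * z * h)%g == y).

(** If [z] and [y] have the same monomial, then [y = s * z * h0] with [s] in [R] and [h0] in [H],
    and translating [r] and [h] by these matches the two counts. Otherwise [y] lies outside the
    double coset of [z]. *)
Lemma dcoset_countE z y :
  dcoset_count z y = if mon z == mon y then dcoset_count y y else 0%N.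
Proof.
case: eqP => [/bimonP [s [Rs Ew]] | Nm].
  pose h0 := ((s * z)^-1 * y)%g.
  have Hh0 : h0 \in H.
    apply/word_stabP=> k; rewrite permM Ew.
    have Ek : k = (s * z)%g ((s * z)^-1 k)%g by rewrite permKV.
    by rewrite {2}Ek permM.
  have Ey : y = (s * z * h0)%g by rewrite mulgA mulgV mul1g.
  clearbody h0.
  rewrite {2}/dcoset_count (reindex_inj (mulIg s^-1%g)) /=.
  apply: eq_big => r; first by rewrite groupMr ?groupV.
  move=> _; rewrite [RHS](reindex_inj (mulgI h0^-1%g)) /=.
  apply: eq_big => h; first by rewrite groupMl ?groupV.
  move=> _; have -> : (r * s^-1 * y * (h0^-1 * h) = r * z * h)%g; last by [].
  by rewrite {1}Ey !mulgA mulgKV; congr (_ * h)%g; rewrite mulgK.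
apply: big1 => r Rr; apply: big1 => h Hh; apply/eqP; rewrite eqb0.
apply/eqP=> Ey; case: Nm; apply/bimonP; exists r; split=> // k.
by rewrite -Ey !permM (word_stabP _ _ Hh).
Qed.

Lemma dcoset_count_gt0 y : (0 < dcoset_count y y)%N.
Proof.
rewrite /dcoset_count (bigD1 1%g) //= (bigD1 1%g) //=.
by rewrite mul1g mulg1 eqxx.
Qed.

(** For each [c], the terms that contribute to [y] are the pairs [(r, h)] with [r * c * g * h = y].
    By [dcoset_countE] their number is a factor depending only on [y], times the indicator that
    [c * g] and [y] have the same monomial; [bidetE] sums these indicators with signs. *)
Lemma young_avg_coef g y :
  (ys *m aG g *m avg_mx H aG) 0 (gring_index G y) =
  #|H|%:R^-1 * ((dcoset_count y y)%:R *
    (bidet rw cl (fun k => w (g k)))@_(mon y)).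
Proof.
rewrite -scalemxAr mxE; congr (_ * _).
have->: (bidet rw cl (fun k => w (g k)))@_(mon y) =
    \sum_(c in word_stab cl) (-1) ^+ c * (mon (c * g)%g == mon y)%:R.
  rewrite bidetE raddf_sum; apply: eq_bigr => c _.
  rewrite /= mcoeffZ mcoeffX; congr (_ * (_ == _)%:R).
  by apply/mnmP=> i; rewrite !bimonE; apply: eq_content => k; rewrite permM.
rewrite mulr_sumr young_regular mulmx_suml summxE row_stabE.
transitivity (\sum_(c in word_stab cl) (-1) ^+ c * (dcoset_count (c * g) y)%:R : algC).
  transitivity (\sum_(r in R) \sum_(c in word_stab cl) (-1) ^+ c *
      (\sum_(h in H) ((r * (c * g) * h)%g == y))%:R : algC).
    apply: eq_bigr => r _; rewrite mulmx_suml summxE; apply: eq_bigr => c _.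
    rewrite -scalemxAl mulmx_sumr mxE summxE natr_sum; congr (_ * _).
    by apply: eq_bigr => h _; rewrite delta_regular delta_coef !mulgA.
  rewrite exchange_big; apply: eq_bigr => c _ /=.
  by rewrite -mulr_sumr -natr_sum.
apply: eq_bigr => c _; rewrite mulrCA; congr (_ * _).
rewrite dcoset_countE; case: eqP => _; by rewrite ?mulr1 ?mulr0.
Qed.

Lemma specht_avg :
  #|word_stab w|%:R^-1 * \sum_(h in word_stab w) specht_char m la h =
    (poly_rank (fun g : 'S_m => bidet rw cl (fun k => w (g k))))%:R.
Proof.
rewrite (@cfRepr_avg _ _ H) ?subsetT //; congr (_%:R).
rewrite (eqmxMr _ young_mxE); apply: poly_rankE => x.
have E j : (x *m (young_mx *m avg_mx H aG)) 0 j =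
    #|H|%:R^-1 * ((dcoset_count (enum_val j) (enum_val j))%:R *
    (\sum_k x 0 k *: bidet rw cl (fun i => w ((enum_val k : 'S_m) i)))@_
      (mon (enum_val j))).
  rewrite mxE [X in _ * (_ * X)]raddf_sum !mulr_sumr; apply: eq_bigr => k _.
  have->: (young_mx *m avg_mx H aG) k j = row k (young_mx *m avg_mx H aG) 0 j
    by rewrite [RHS]mxE.
  rewrite row_mul rowK -[j in LHS]gring_valK young_avg_coef /= mcoeffZ.
  by rewrite mulrCA; congr (_ * _); rewrite mulrCA.
split=> [x0 | S0]; last by apply/rowP=> j; rewrite E S0 mcoeff0 !mulr0 mxE.
apply/mpolyP=> mn; rewrite mcoeff0.
(* The coefficient of [mon y] is seen by the coordinate at [y], whose factor is nonzero; no other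
   monomial occurs in these bideterminants. *)
case: (boolP [exists y : 'S_m, mn == mon y]) => [/existsP [y /eqP->] | /existsPn Ny].
  have := E (gring_index G y); rewrite x0 mxE gring_indexK ?inE // => /esym/eqP.
  by rewrite !mulf_eq0 invr_eq0 !pnatr_eq0 !eqn0Ngt dcoset_count_gt0 cardG_gt0 => /eqP.
rewrite raddf_sum big1 // => k _; rewrite /= mcoeffZ bidetE raddf_sum /=.
rewrite big1 ?mulr0 // => c _; rewrite mcoeffZ mcoeffX.
rewrite (_ : (_ == mn) = false) ?mulr0 //; apply/negbTE.
apply: contra (Ny (c * enum_val k)%g) => /eqP <-; apply/eqP/mnmP=> i.
by rewrite !bimonE; apply: eq_content => j; rewrite permM.
Qed.
End Fixed.
End SpechtRank.

(** * Partitions and dominance *)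

Section Diagram.
Variables (m : nat) (row cl : 'I_m -> nat).
Hypothesis cell_up :
  forall x i, (i < row x)%N -> exists y, row y = i /\ cl y = cl x.

Let cnt (v : 'I_m -> nat) k j := #|[pred x | (v x < k)%N && (cl x == j)]|.

Definition column_injective (T : Type) (v : 'I_m -> T) :=
  forall x y, cl x = cl y -> v x = v y -> x = y.

(** If column [j] has a cell in row [k] or beyond, its rows include all of 0, ..., [k - 1], while at
    most [k] distinct values lie below [k]. If not, every cell of the column is counted on the
    right. *)
Lemma cnt_le v k j : column_injective v -> (cnt v k j <= cnt row k j)%N.
Proof.
move=> vI; case: (boolP [exists x, (cl x == j) && (k <= row x)%N]).
  case/existsP=> x0 /andP[/eqP cx0 kx0]; apply: (@leq_trans k).
    rewrite /cnt -[X in (_ <= X)%N](size_iota 0) cardE -(size_map v).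
    apply: uniq_leq_size.
      rewrite map_inj_in_uniq ?enum_uniq // => x y.
      rewrite !mem_enum !inE => /andP[_ /eqP cx] /andP[_ /eqP cy].
      by apply: vI; rewrite cx.
    move=> i /mapP [x]; rewrite mem_enum inE => /andP[vx _] ->.
    by rewrite mem_iota.
  rewrite /cnt -[X in (X <= _)%N](size_iota 0) cardE -(size_map row).
  apply: uniq_leq_size; first exact: iota_uniq.
  move=> i; rewrite mem_iota /= add0n => ik.
  have [y [ry cy]] := cell_up (leq_trans ik kx0).
  by rewrite -ry; apply: map_f; rewrite mem_enum inE ry ik cy cx0 eqxx.
rewrite negb_exists => /forallP Nx; apply: subset_leq_card.
apply/subsetP=> x; rewrite !inE => /andP[_ cx]; rewrite cx andbT.
by have := Nx x; rewrite cx /= -ltnNge.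
Qed.

Let cl_bound := (\max_x cl x).+1.

Lemma sum_cnt v k : #|[pred x | (v x < k)%N]| = \sum_(j < cl_bound) cnt v k j.
Proof.
rewrite -sum1_card (partition_big (fun x => inord (cl x) : 'I_cl_bound) predT) //.
apply: eq_bigr => j _; rewrite /cnt -sum1_card; apply: eq_bigl => x.
rewrite !inE; congr andb; rewrite -(inj_eq val_inj) /= inordK //.
by rewrite ltnS (leq_bigmax x).
Qed.

Lemma column_injective_dominance v k : column_injective v ->
  (#|[pred x | (v x < k)%N]| <= #|[pred x | (row x < k)%N]|)%N.
Proof. by move=> vI; rewrite !sum_cnt leq_sum // => j _; apply: cnt_le. Qed.

(** Equal totals force equality in [cnt_le] for every column, so [v] and [row] take the same values
    in each column with the same multiplicities. *)
Lemma column_injective_eq v : column_injective v ->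
    (forall k, #|[pred x | (v x < k)%N]| = #|[pred x | (row x < k)%N]|) ->
  exists s : 'S_m, s \in word_stab cl /\ forall x, v x = row (s x).
Proof.
move=> vI E; have cntE k j : (j < cl_bound)%N -> cnt v k j = cnt row k j.
  move=> jb; pose j' := Ordinal jb; have := E k; rewrite !sum_cnt => /eqP.
  have /leqif_sum/leqifP : forall j : 'I_cl_bound, true ->
      (cnt v k j <= cnt row k j ?= iff (cnt v k j == cnt row k j))%N.
    by move=> i _; split=> //; apply: cnt_le.
  case: ifP => [/forallP H _ _ | _ lt /eqP eq]; last by rewrite eq ltnn in lt.
  by apply/eqP; apply: (H j').
have cntS u i j : cnt u i.+1 j = (cnt u i j + content (fun x => (u x, cl x)) (i, j))%N.
  rewrite /cnt /content -!sum1_card.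
  rewrite (bigID (fun x => (u x < i)%N)) /=; congr addn.
    by apply: eq_bigl => x; rewrite !inE; case: ltngtP; lia.
  apply: eq_bigl => x; rewrite !inE xpair_eqE; lia.
have [[i j]|s Es] := @same_content m _ (fun x => (row x, cl x)) (fun x => (v x, cl x)).
  have [jb | bj] := ltnP j cl_bound.
    by apply: (@addnI (cnt row i j)); rewrite -cntS -!cntE // -cntS.
  rewrite /content !eq_card0 // => x; rewrite !inE xpair_eqE;
    apply/negP=> /andP[_ /eqP cx].
  + by have := leq_bigmax (F := cl) x; rewrite cx; rewrite /cl_bound in bj; lia.
  by have := leq_bigmax (F := cl) x; rewrite cx; rewrite /cl_bound in bj; lia.
exists s; split; last by move=> x; case: (Es x).
by apply/word_stabP=> x; case: (Es x).
Qed.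
End Diagram.

(** * Partial sums, rows of diagrams and trailing zeros *)

Section Partitions.
Local Open Scope nat_scope.
Implicit Types (la mu sh : seq nat).

Definition psum sh k := \sum_(i < k) nth 0 sh i.

Lemma psumS sh k : psum sh k.+1 = psum sh k + nth 0 sh k.
Proof. exact: big_ord_recr. Qed.

Lemma psumE sh k : psum sh k = sumn (take k sh).
Proof.
rewrite /psum; elim: k => [|k IHk]; first by rewrite big_ord0 take0.
rewrite big_ord_recr /= IHk; have [ks | sk] := ltnP k (size sh).
  by rewrite (take_nth 0 ks) sumn_rcons.
by rewrite nth_default // addn0 !take_oversize // ltnW.
Qed.

Lemma leq_psum sh k k' : k <= k' -> psum sh k <= psum sh k'.
Proof.
move=> kk'; rewrite /psum -!(big_mkord xpredT (nth 0 sh)).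
by rewrite (@big_cat_nat _ _ _ k 0 k') //= leq_addr.
Qed.

Lemma psum_le_sumn sh k : psum sh k <= sumn sh.
Proof. by rewrite psumE -{2}(cat_take_drop k sh) sumn_cat leq_addr. Qed.

Lemma reshape_cell sh x : x < sumn sh ->
  psum sh (reshape_index sh x) + reshape_offset sh x = x.
Proof. by rewrite psumE => _; apply: reshape_indexK. Qed.

Lemma reshape_index_lt sh x k : x < sumn sh ->
  (reshape_index sh x < k) = (x < psum sh k).
Proof.
move=> xs; have Ex := reshape_cell xs; have oo := reshape_offsetP xs.
have [rk | kr] := ltnP.
  have := leq_psum sh rk; rewrite psumS; lia.
have := leq_psum sh kr; lia.
Qed.

Lemma card_ord_lt m c : c <= m -> #|[pred x : 'I_m | x < c]| = c.
Proof.
move=> cm; rewrite -sum1_card -(big_ord_widen_cond m xpredT (fun=> 1)) //.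
by rewrite sum1_card card_ord.
Qed.

Lemma card_rows m sh k : sumn sh = m ->
  #|[pred x : 'I_m | reshape_index sh x < k]| = psum sh k.
Proof.
move=> Es; rewrite -[RHS](@card_ord_lt m) -?Es ?psum_le_sumn //.
by apply: eq_card => x; rewrite !inE reshape_index_lt.
Qed.

Lemma card_row m sh i : sumn sh = m ->
  #|[pred x : 'I_m | reshape_index sh x == i]| = nth 0 sh i.
Proof.
move=> Es; apply: (@addnI (psum sh i)).
rewrite -psumS.
rewrite -!(card_rows _ Es) -!sum1_card.
rewrite [RHS](bigID (fun x : 'I_m => reshape_index sh x < i)) /=.
by congr addn; apply: eq_bigl => x; rewrite !inE; lia.
Qed.

Lemma word_exists m n (g : 'I_n -> nat) : \sum_j g j = m ->
  exists w : {ffun 'I_m -> 'I_n}, content w =1 g.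
Proof.
move=> gm; pose sh := codom g.
have Es : sumn sh = m by rewrite sumnE big_map -gm big_enum.
have shs : size sh = n by rewrite size_map size_enum_ord.
have H (x : 'I_m) : reshape_index sh x < n.
  by rewrite -shs reshape_indexP // Es.
exists [ffun x => Ordinal (H x)] => j.
have -> : g j = nth 0 sh j.
  by rewrite /sh (nth_map j) ?size_enum_ord // nth_ord_enum.
rewrite -(card_row j Es); apply: eq_card => x.
by rewrite !inE ffunE -val_eqE.
Qed.

Lemma sum_content m n (w : 'I_m -> 'I_n) : \sum_j content w j = m.
Proof.
rewrite -[RHS](card_ord m) -[RHS]sum1_card [RHS](partition_big w predT) //=.
by apply: eq_bigr => j _; rewrite /content -sum1_card.
Qed.

Lemma part_nth la i j : sorted geq la -> i <= j -> nth 0 la j <= nth 0 la i.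
Proof.
move=> sla ij; have [js | sj] := ltnP j (size la); last by rewrite nth_default.
have geqT : transitive geq by move=> a b c /= ba ac; apply: leq_trans ac ba.
by apply: (sorted_leq_nth geqT leqnn 0 sla) => //; rewrite inE ?(leq_ltn_trans ij).
Qed.

Lemma part_length_nth la i : sorted geq la -> (0 < nth 0 la i) = (i < part_length la).
Proof.
elim: la i => [|a la IH] i sla; first by rewrite nth_nil.
have sla' : sorted geq la by apply: path_sorted sla.
rewrite /part_length /= -/(part_length la).
have [a0 | a_gt0] := posnP a; last by case: i => [|i] //=; rewrite IH // add1n.
have la0 i' : nth 0 la i' = 0.
  by have := part_nth sla (leq0n i'.+1); rewrite /= a0; lia.
have -> : part_length la = 0 by apply/eqP; rewrite -leqn0 leqNgt -IH // la0.
by rewrite a0; case: i => //= i; rewrite la0.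
Qed.

Lemma psum_part_length la n : sorted geq la -> part_length la <= n ->
  psum la n = sumn la.
Proof.
move=> sla ln; rewrite psumE -{2}(cat_take_drop n la) sumn_cat.
suff -> : sumn (drop n la) = 0 by rewrite addn0.
apply/eqP; rewrite sumnE big_seq big1 // => x /(nthP 0) [i _ <-].
rewrite nth_drop; apply/eqP; rewrite -leqn0 leqNgt part_length_nth //; lia.
Qed.

Lemma nth_add_const la a n i :
  nth 0 (add_const la a n) i = if i < n then nth 0 la i + a else 0.
Proof.
case: ltnP => ni; first by rewrite nth_mkseq.
by rewrite nth_default // size_mkseq.
Qed.

Lemma is_partition_add_const m la a n : is_partition m la -> part_length la <= n ->
  is_partition (m + n * a) (add_const la a n).
Proof.
move=> /andP[sla /eqP Es] ln; apply/andP; split.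
  have geqT : transitive geq by move=> x y z /= yx zy; apply: leq_trans zy yx.
  apply/(sortedP 0) => i; rewrite size_mkseq => i1n.
  by rewrite !nth_mkseq ?(ltnW i1n) //= leq_add2r part_nth.
rewrite sumnE big_map -[X in iota 0 X]subn0 big_mkord big_split /= sum_nat_const card_ord.
by rewrite -/(psum la n) psum_part_length // Es.
Qed.

Lemma part_length_size sh : part_length sh <= size sh.
Proof. exact: count_size. Qed.

Lemma part_length_add_const la a n : part_length (add_const la a n) <= n.
Proof. by apply: leq_trans (part_length_size _) _; rewrite size_mkseq. Qed.

Lemma add_const_eq la mu a n :
  (forall i, nth 0 la i = nth 0 mu i) -> add_const la a n = add_const mu a n.
Proof. by move=> E; apply: eq_map => i; rewrite E. Qed.

Lemma add_constD la a b n :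
  add_const (add_const la a n) b n = add_const la (a + b) n.
Proof.
apply: (@eq_from_nth _ 0) => [|i]; rewrite !size_mkseq // => ni.
by rewrite !nth_add_const ni addnA.
Qed.

Lemma reshape_index_eq la mu x : (forall i, nth 0 la i = nth 0 mu i) ->
  x < sumn la -> reshape_index la x = reshape_index mu x.
Proof.
move=> E xs; have oo := reshape_offsetP xs; rewrite E in oo.
rewrite -[RHS](congr1 (reshape_index mu) (reshape_indexK la x)).
have -> : flatten_index la (reshape_index la x) (reshape_offset la x) =
          flatten_index mu (reshape_index la x) (reshape_offset la x).
  rewrite /flatten_index -!psumE; congr addn.
  by apply: eq_bigr => i _.
by rewrite flatten_indexKl.
Qed.

Lemma reshape_offset_eq la mu x : (forall i, nth 0 la i = nth 0 mu i) ->
  x < sumn la -> reshape_offset la x = reshape_offset mu x.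
Proof.
move=> E xs; rewrite /reshape_offset (reshape_index_eq E xs) -!psumE.
by congr subn; apply: eq_bigr => i _.
Qed.
End Partitions.

(** * Unitriangularity of weight multiplicities *)

Section SpechtCharacters.
Local Open Scope nat_scope.
Implicit Types (la mu sh : seq nat).

Lemma cell_inj m la (x y : 'I_m) : reshape_index la x = reshape_index la y ->
  reshape_offset la x = reshape_offset la y -> x = y.
Proof.
by move=> Er Eo; apply: val_inj;
  rewrite /= -(reshape_indexK la x) Er Eo reshape_indexK.
Qed.

Lemma cell_up m la (x : 'I_m) i : is_partition m la -> i < reshape_index la x ->
  exists y : 'I_m, reshape_index la y = i /\ reshape_offset la y = reshape_offset la x.
Proof.
case/andP=> sla /eqP Es ix; have xs : x < sumn la by rewrite Es.
have oi : reshape_offset la x < nth 0 la i.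
  exact: leq_trans (reshape_offsetP xs) (part_nth sla (ltnW ix)).
have ys : flatten_index la i (reshape_offset la x) < m
  by have := flatten_indexP oi; rewrite Es.
by exists (Ordinal ys); rewrite /= flatten_indexKl ?flatten_indexKr.
Qed.

Lemma row_word m la l : is_partition m la -> part_length la <= l ->
  exists rw : 'I_m -> 'I_l, forall k, rw k = reshape_index la k :> nat.
Proof.
case/andP=> sla /eqP Es ll; have H (k : 'I_m) : reshape_index la k < l.
  apply: leq_trans ll; rewrite -part_length_nth //.
  by apply: leq_ltn_trans (reshape_offsetP _); rewrite // Es.
by exists (fun k => Ordinal (H k)).
Qed.

Lemma content_row m la l (rw : 'I_m -> 'I_l) :
    is_partition m la -> (forall k, rw k = reshape_index la k :> nat) ->
  content rw =1 fun j => nth 0 la j.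
Proof.
case/andP=> _ /eqP Es rwE j; rewrite -(card_row j Es).
by apply: eq_card => x; rewrite !inE -rwE val_eqE.
Qed.

Lemma card_lt_content m n (u : 'I_m -> 'I_n) k :
  #|[pred x | u x < k]| = \sum_(j < n | j < k) content u j.
Proof.
rewrite -sum1_card (partition_big u (fun j : 'I_n => j < k)) //=.
apply: eq_bigr => j jk; rewrite /content -sum1_card; apply: eq_bigl => x.
by rewrite !inE; case: eqP => [-> | _]; rewrite ?andbF // jk.
Qed.

Lemma specht_psi m la l n (rw : 'I_m -> 'I_l) (w : {ffun 'I_m -> 'I_n}) g :
    (forall k, rw k = reshape_index la k :> nat) -> content w =1 g ->
  ('[specht_char m la, psi m g] =
    (poly_rank (fun s : 'S_m =>
      bidet rw (fun k => reshape_offset la k) (fun k => w (s k))))%:R)%R.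
Proof. by move=> rwE wg; rewrite (cfdot_psi _ wg) (specht_avg w rwE). Qed.

(** A nonzero multiplicity yields a nonzero bideterminant, hence a filling of content [g] with
    distinct letters in each column. *)
Lemma specht_psi_dominance m la n (g : 'I_n -> nat) k :
    is_partition m la -> ('[specht_char m la, psi m g] != 0)%R ->
  \sum_(j < n | j < k) g j <= psum la k.
Proof.
move=> pla; have [rw rwE] := row_word pla (leqnn _).
case: (boolP [exists w, w \in word_set m g]) => [|/existsPn Nw]; last first.
  by rewrite cfdot_psi_eq0 ?eqxx // => w /word_setP; apply/negP.
case/existsP=> w /word_setP wg; rewrite (specht_psi rwE wg) pnatr_eq0.
case/poly_rank_neq0=> s bs.
have vI : column_injective (fun k => reshape_offset la k) (fun x => w (s x) : nat).
  by move=> x y cxy /val_inj; apply: bidet_inj bs cxy.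
have := column_injective_dominance (fun x y => @cell_up m la x y pla) k vI.
rewrite (card_lt_content (fun x => w (s x))) card_rows;
  last by case/andP: pla => _ /eqP.
by congr (_ <= _); apply: eq_bigr => j _; rewrite content_perm wg.
Qed.

(** Filling each cell with its row number gives a nonzero bideterminant. Any other nonzero one of
    this content is in the equality case of dominance, so it differs by a column permutation, that
    is, by a sign. *)
Lemma specht_psi_diag m la n : is_partition m la -> part_length la <= n ->
  ('[specht_char m la, psi m (fun j : 'I_n => nth 0 la j)] = 1)%R.
Proof.
move=> pla ln; have [rw rwE] := row_word pla ln.
have wg := content_row pla rwE.
have wg' : content (finfun rw) =1 fun j : 'I_n => nth 0 la j.
  by move=> j; rewrite -wg; apply: eq_content => k; rewrite ffunE.
rewrite (specht_psi rwE wg') -[RHS]/(1%:R)%R; congr (_%:R)%R.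
set cl := fun k : 'I_m => reshape_offset la k.
have b1 : (bidet rw cl rw != 0)%R.
  apply: bidet_diag_neq0 => x y rxy; apply: cell_inj; rewrite -!rwE rxy //.
have E1 : bidet rw cl (fun k => finfun rw ((1%g : 'S_m) k)) = bidet rw cl rw.
  by apply: eq_bidet => // k; rewrite ffunE perm1.
apply: (@poly_rank_line _ _ _ (1%g : 'S_m)); rewrite E1 // => s.
have [-> | bs] := eqVneq (bidet rw cl (fun k => finfun rw (s k))) 0%R.
  by exists 0%R; rewrite scale0r.
have vI : column_injective cl (fun x => finfun rw (s x) : nat).
  by move=> x y cxy /val_inj; apply: bidet_inj bs cxy.
have [k | c [cc Ec]] := column_injective_eq (fun x y => @cell_up m la x y pla) vI.
  rewrite (card_lt_content (fun x => finfun rw (s x))) card_rows;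
    last by case/andP: pla => _ /eqP.
  rewrite -(card_rows k (m := m)); last by case/andP: pla => _ /eqP.
  rewrite (eq_card (B := [pred x | rw x < k])) => [|x]; last by rewrite !inE rwE.
  by rewrite card_lt_content; apply: eq_bigr => j _; rewrite content_perm wg' wg.
exists ((-1) ^+ c)%R; rewrite scaler_sign -mulr_sign -bidet_perm //.
by apply: eq_bidet => // k; apply: val_inj; rewrite /= Ec rwE.
Qed.

Lemma specht_char_eq m la mu : sumn la = m -> (forall i, nth 0 la i = nth 0 mu i) ->
  specht_char m la = specht_char m mu.
Proof.
move=> Es E; rewrite /specht_char /specht_repr.
have -> : young_symmetrizer m la = young_symmetrizer m mu; last by [].
have RE : row_stab m la = row_stab m mu.
  by apply/setP=> s; rewrite !inE; apply: eq_forallb => k;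
    rewrite !(reshape_index_eq E) ?Es.
have CE : col_stab m la = col_stab m mu.
  by apply/setP=> s; rewrite !inE; apply: eq_forallb => k;
    rewrite !(reshape_offset_eq E) ?Es.
by rewrite /young_symmetrizer RE CE.
Qed.

End SpechtCharacters.

(** * Adding columns of full height *)

Section SpechtShift.
Local Open Scope nat_scope.
Variables (m m' p : nat) (la : seq nat).
Hypotheses (pla : is_partition m la) (lp : part_length la <= p) (Em : m' = m + p).
Local Notation la' := (add_const la 1 p).

Lemma shifted_partition : is_partition m' la'.
Proof. by rewrite Em -{1}[p]muln1; apply: is_partition_add_const. Qed.

Lemma shift_cells : exists e : 'I_(p + m) -> 'I_m',
  [/\ injective e,
      forall i, reshape_index la' (e (lshift m i)) = i /\
                reshape_offset la' (e (lshift m i)) = 0 &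
      forall k, reshape_index la' (e (rshift p k)) = reshape_index la k /\
                reshape_offset la' (e (rshift p k)) = (reshape_offset la k).+1].
Proof.
have [rw rwE] := row_word pla lp.
have Es' : sumn la' = m' by case/andP: shifted_partition => _ /eqP.
pose r (x : 'I_(p + m)) : 'I_p := match split x with inl i => i | inr k => rw k end.
pose c (x : 'I_(p + m)) := if split x is inr k then (reshape_offset la k).+1 else 0.
have cr x : c x < nth 0 la' (r x).
  rewrite nth_add_const ltn_ord /c /r addn1; case: split => // k.
  rewrite rwE ltnS; apply: reshape_offsetP.
  by case/andP: pla => _ /eqP ->.
have eP x : flatten_index la' (r x) (c x) < m'.
  by have := flatten_indexP (cr x); rewrite Es'.
pose e x := Ordinal (eP x).
have eI x : reshape_index la' (e x) = r x :> nat by rewrite flatten_indexKl.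
have eO x : reshape_offset la' (e x) = c x by rewrite flatten_indexKr.
have rl i : r (lshift m i) = i by rewrite /r (unsplitK (inl i)).
have cl i : c (lshift m i) = 0 by rewrite /c (unsplitK (inl i)).
have rr k : r (rshift p k) = rw k by rewrite /r (unsplitK (inr k)).
have cR k : c (rshift p k) = (reshape_offset la k).+1 by rewrite /c (unsplitK (inr k)).
clearbody e; exists e.
split; last by move=> k; rewrite eI eO rr cR rwE.
  move=> x y exy.
  have := eI x; rewrite exy eI => /val_inj; have := eO x; rewrite exy eO.
  case: (split_ordP x) => i ->; case: (split_ordP y) => j ->;
    rewrite ?cl ?cR ?rl ?rr //.
    by move=> _ ->.
  move=> [Eo] /(congr1 val); rewrite /= !rwE => Er.
  by congr rshift; apply/esym: (cell_inj Er Eo).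
by move=> i; rewrite eI eO rl cl.
Qed.

Lemma specht_psi_shift (g : 'I_p -> nat) :
  '[specht_char m' la', psi m' (fun j => (g j).+1)]%R = '[specht_char m la, psi m g]%R.
Proof.
have Sg : \sum_j (g j).+1 = \sum_j g j + p.
  rewrite (eq_bigr (fun j => g j + 1)) => [|j _]; last by rewrite addn1.
  by rewrite big_split /= sum1_card card_ord.
have [gm | gm] := eqVneq (\sum_j g j) m; last first.
  rewrite !cfdot_psi_eq0 // => w wg; case/eqP: gm.
    by rewrite -(sum_content w); apply: eq_bigr => j _; rewrite wg.
  apply: (@addIn p); rewrite -Sg -Em -(sum_content w).
  by apply: eq_bigr => j _; rewrite wg.
have g'm : \sum_j (g j).+1 = m' by rewrite Sg gm Em.
have [w wg] := word_exists gm; have [w' wg'] := word_exists g'm.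
have [rw rwE] := row_word pla lp.
have [rw' rwE'] := row_word shifted_partition (part_length_add_const la 1 p).
have [e [eI el er]] := shift_cells.
rewrite (specht_psi rwE' wg') (specht_psi rwE wg); congr (_%:R)%R.
apply: (poly_rank_shift _ eI); first by rewrite Em addnC.
- by move=> i; apply: val_inj; rewrite /= rwE'; case: (el i).
- by move=> i; case: (el i).
- by move=> k; apply: val_inj; rewrite /= rwE' rwE; case: (er k).
- by move=> k; case: (er k).
- by move=> j; rewrite wg' wg.
Qed.

Lemma specht_psi_shift0 (g : 'I_p -> nat) j : g j = 0 ->
  ('[specht_char m' la', psi m' g] = 0)%R.
Proof.
move=> gj; case: (boolP [exists w, w \in word_set m' g]) => [|/existsPn Nw];
  last first.
  by rewrite cfdot_psi_eq0 // => w /word_setP; apply/negP.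
case/existsP=> w /word_setP wg.
have [rw rwE] := row_word pla lp.
have [rw' rwE'] := row_word shifted_partition (part_length_add_const la 1 p).
have [e [eI el er]] := shift_cells.
rewrite (specht_psi rwE' wg).
rewrite (@poly_rank_shift0 p m m' rw (fun k => reshape_offset la k) rw' _ e
           _ eI _ _ _ _ _ j) //.
- by rewrite Em addnC.
- by move=> i; apply: val_inj; rewrite /= rwE'; case: (el i).
- by move=> i; case: (el i).
- by move=> k; apply: val_inj; rewrite /= rwE' rwE; case: (er k).
- by move=> k; case: (er k).
- by rewrite wg.
Qed.
End SpechtShift.

Section SpechtIteratedShift.
Local Open Scope nat_scope.
Variables (m p : nat) (la : seq nat).
Hypotheses (pla : is_partition m la) (lp : part_length la <= p).

Lemma specht_psi_addc t m' (g : 'I_p -> nat) : m' = m + p * t ->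
  '[specht_char m' (add_const la t p), psi m' (fun j => (g j + t)%N)]%R =
  '[specht_char m la, psi m g]%R.
Proof.
elim: t m' g => [|t IHt] m' g Em.
  rewrite muln0 addn0 in Em; rewrite Em.
  rewrite (@eq_psi _ _ _ g) => [|j]; last by rewrite addn0.
  (* The list [add_const la 0 p] may differ from [la] by trailing zeros. *)
  rewrite -(@specht_char_eq m la) //; first by case/andP: pla => _ /eqP.
  move=> i; rewrite nth_add_const addn0; case: ltnP => // pi.
  apply/eqP; rewrite -leqn0 leqNgt part_length_nth; last by case/andP: pla.
  by rewrite -leqNgt (leq_trans lp).
have pt := is_partition_add_const t pla lp.
rewrite -(IHt _ g erefl).
rewrite -(specht_psi_shift pt (part_length_add_const _ _ _) (m' := m')); last first.
  by rewrite Em mulnS; lia.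
rewrite add_constD addn1; congr '[_, _]%R.
by apply: eq_psi => j; rewrite addnS.
Qed.

(** Removing one full column lowers every letter count by one; some count reaches 0 while a full
    column remains. *)
Lemma specht_psi_addc0 t m' (g : 'I_p -> nat) j : m' = m + p * t -> g j < t ->
  ('[specht_char m' (add_const la t p), psi m' g] = 0)%R.
Proof.
elim: t m' g => [|t IHt] m' g // Em gt.
have pt := is_partition_add_const t pla lp.
have Em' : m' = m + p * t + p by rewrite Em mulnS; lia.
have -> : add_const la t.+1 p = add_const (add_const la t p) 1 p.
  by rewrite add_constD addn1.
case: (boolP [exists i, g i == 0]) => [/existsP [i /eqP gi] | /existsPn Ng].
  exact: (specht_psi_shift0 pt (part_length_add_const _ _ _) Em' gi).
rewrite (@eq_psi _ _ _ (fun i => (g i).-1.+1)) => [|i]; last first.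
  by rewrite prednK // lt0n.
rewrite (specht_psi_shift pt (part_length_add_const _ _ _) Em') IHt //.
by have := Ng j; lia.
Qed.
End SpechtIteratedShift.

(** * Irreducibility *)

Section SpechtIrreducible.
Variables (m : nat) (la : seq nat).
Hypothesis pla : is_partition m la.
Local Notation G := [set: 'S_m].
Local Notation aG := (regular_repr algC G).
Local Notation ys := (young_symmetrizer m la).
Local Notation U := (cyclic_mx aG ys).

Lemma regular_coef (u : 'rV[algC]_#|G|) x y :
  (u *m aG x) 0 (gring_index G y) = u 0 (gring_index G (y * x^-1)%g).
Proof.
rewrite mxE (bigD1 (gring_index G (y * x^-1)%g)) //= big1 => [|i ni].
  by rewrite addr0 mxE gring_indexK ?inE // mulgKV delta_coef eqxx mulr1.
rewrite mxE delta_coef; case: eqP => [Ey | _]; last by rewrite mulr0.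
by rewrite -Ey mulgK gring_valK eqxx in ni.
Qed.

(** The Young symmetrizer starts with the sum over the row stabilizer, so left multiplication by [r]
    preserves its coefficients. Its right translates inherit this and span [U]. *)
Lemma young_row_invariant (u : 'rV[algC]_#|G|) r y : r \in row_stab m la ->
  (u <= U)%MS -> u 0 (gring_index G (r * y)%g) = u 0 (gring_index G y).
Proof.
have [rw rwE] := row_word pla (leqnn _); have RE := row_stabE rwE.
rewrite RE => Rr; rewrite young_mxE => /submxP [x ->].
have ysE z : ys 0 (gring_index G (r * z)%g) = ys 0 (gring_index G z).
  rewrite !summxE RE (reindex_inj (mulgI r)) /=.
  apply: eq_big => s; first by rewrite (groupMl _ Rr).
  move=> _; rewrite !summxE; apply: eq_bigr => c _; 
  have scaleE a (A : 'rV[algC]_#|G|) j : (a *: A) 0 j = a * A 0 j by rewrite mxE.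
  by rewrite !scaleE !delta_coef -mulgA (inj_eq (mulgI r)).
have yE k j : young_mx m la k j = (ys *m aG (enum_val k)) 0 j by rewrite mxE.
rewrite mxE [RHS]mxE; apply: eq_bigr => k _; congr (_ * _).
by rewrite !yE !regular_coef -mulgA ysE.
Qed.

(** Averages reveal every coefficient: translate [u] by [y^-1] and average over [R]; by row
    invariance the coefficient at 1 is that of [u] at [y]. *)
Lemma submodule_avg_eq0 (R : {group 'S_m}) (V : 'M[algC]_#|G|) :
    R = row_stab m la :> {set 'S_m} -> mxmodule aG V -> (V <= U)%MS ->
  V *m avg_mx R aG = 0 -> V = 0.
Proof.
move=> RE modV VU V0; apply/row_matrixP=> i; rewrite row0.
set u := row i V; apply/rowP=> j; rewrite [RHS]mxE -[j]gring_valK.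
set y := enum_val j; have uV : (u <= V)%MS by apply: row_sub.
have : (u *m aG y^-1%g *m avg_mx R aG) 0 (gring_index G 1%g) = 0.
  have /submxP [x ->] : (u *m aG y^-1%g <= V)%MS by rewrite mxmodule_trans ?inE.
  by rewrite -mulmxA V0 mulmx0 mxE.
rewrite -scalemxAr mulmx_sumr mxE summxE => /eqP.
rewrite mulf_eq0 invr_eq0 (negPf (neq0CG _)) /= (eq_bigr (fun=> u 0 (gring_index G y))).
  by rewrite sumr_const mulrn_eq0 eqn0Ngt cardG_gt0 => /eqP.
move=> h Rh; rewrite !regular_coef invgK mul1g young_row_invariant //.
  by rewrite -RE groupV.
exact: submx_trans uV VU.
Qed.

(* The row-invariants of U form a line, while each nonzero submodule of U has
   nonzero row-invariants: so U is not a sum of two nonzero submodules. *)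
Lemma specht_char_irr : specht_char m la \in irr G.
Proof.
have [rw rwE] := row_word pla (leqnn _); have RE := row_stabE rwE.
pose R := word_stab_group rw; pose E := avg_mx R aG.
pose modU := cyclic_mx_module aG ys.
have rkUE : \rank (U *m E) = 1%N.
  apply/eqP; rewrite -(eqr_nat algC) -(cfRepr_avg (subsetT R) modU); apply/eqP.
  rewrite mulr1n.
  have wg : content (finfun rw) =1 fun j : 'I_(part_length la) => nth 0%N la j.
    by move=> j; rewrite -(content_row pla rwE); apply: eq_content => k;
      rewrite ffunE.
  have := specht_psi_diag pla (leqnn _); rewrite (cfdot_psi _ wg).
  have -> : word_stab (finfun rw) = R :> {set 'S_m}; last by [].
  by apply/setP=> s; apply/word_stabP/word_stabP=> H k; have := H k; rewrite !ffunE.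
apply/irr_reprP; exists (Representation (specht_repr m la)) => //=.
apply/submod_mx_irr; split=> // [|V modV VU nzV].
  by apply: contra_eqN rkUE => /eqP->; rewrite mul0mx mxrank0.
have redU := mx_reducibleS modU (submx1 U) (mx_Maschke aG (algC'G_pchar G)).
have [W modW defU dxVW] := redU V modV VU.
have UVW : (U <= V + W)%MS by rewrite defU.
have WU : (W <= U)%MS by apply: submx_trans (addsmxSr V W) _; rewrite defU.
have [W0 | nzW] := eqVneq W 0.
  by apply: submx_trans UVW _; rewrite W0 addsmx0.
have rk1 (X : 'M_#|G|) : mxmodule aG X -> (X <= U)%MS -> X != 0 -> (U *m E <= X)%MS.
  move=> modX XU nzX; have XE : (X *m E <= U *m E)%MS by apply: submxMr.
  have nzXE : X *m E != 0.
    by apply: contra nzX => /eqP X0; rewrite (submodule_avg_eq0 _ modX XU X0) ?RE.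
  have /andP [_ UX] : (X *m E == U *m E)%MS.
    by rewrite -(mxrank_leqif_eq XE).2 rkUE eqn_leq lt0n mxrank_eq0 nzXE -{1}rkUE mxrankS.
  apply: submx_trans UX _; rewrite -scalemxAr scalemx_sub // mulmx_sumr.
  rewrite summx_sub // => h _.
  by rewrite mxmodule_trans ?inE.
have : (U *m E <= V :&: W)%MS by rewrite sub_capmx !rk1.
rewrite (mxdirect_addsP dxVW) submx0 => /eqP UE0.
by rewrite UE0 mxrank0 in rkUE.
Qed.
End SpechtIrreducible.

(** Pairing the common character with the [psi] of either partition gives 1, so each partition
    dominates the other. *)
Lemma specht_char_inj m la mu : is_partition m la -> is_partition m mu ->
  specht_char m la = specht_char m mu -> forall i, nth 0%N la i = nth 0%N mu i.
Proof.
have dom (a b : seq nat) k : is_partition m a -> is_partition m b ->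
    specht_char m a = specht_char m b -> (psum b k <= psum a k)%N.
  (* At least [k] letters keep the sum up to [k] whole, and at least [part_length b] letters allow
     [specht_psi_diag]. *)
  move=> pa pb E; pose n := maxn k (part_length b).
  have := @specht_psi_dominance m a n (fun j => nth 0%N b j) k pa.
  rewrite E (specht_psi_diag pb (leq_maxr _ _)) oner_neq0 => /(_ isT).
  by rewrite -(big_ord_widen n (nth 0%N b)) // leq_maxl.
move=> pla pmu E i; have H k : psum la k = psum mu k.
  by apply/eqP; rewrite eqn_leq !dom.
by have := H i.+1; rewrite !psumS H => /addnI.
Qed.

(** * The permutation characters span the class functions *)

Section SameOrbits.
Variable T : finType.
Implicit Types (g h : {perm T}).

Definition porbit_rep g x := odflt x [pick y in porbit g x].

Lemma porbit_repP g x : porbit_rep g x \in porbit g x.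
Proof.
by rewrite /porbit_rep; case: pickP => //= _; apply: porbit_id.
Qed.

Lemma porbit_rep_eq g x y :
  (porbit_rep g x == porbit_rep g y) = (porbit g x == porbit g y).
Proof.
apply/eqP/eqP => E.
  have := porbit_repP g x; rewrite E -eq_porbit_mem => /eqP <-.
  by have := porbit_repP g y; rewrite -eq_porbit_mem => /eqP.
rewrite /porbit_rep E; case: pickP => //= /(_ y).
by rewrite porbit_id.
Qed.

Lemma iter_porbit_mod g x i : iter (i %% #|porbit g x|) g x = iter i g x.
Proof.
rewrite {2}(divn_eq i #|porbit g x|) addnC iterD; congr (iter _ _ _).
by elim: (i %/ _)%N => //= q IHq; rewrite mulSn iterD -IHq iter_porbit.
Qed.

(** On each common orbit, with representative [x0], the conjugating map sends the [i]-th iterate of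
    [g] at [x0] to that of [h]. Both cycles have the length of the orbit, so this is well
    defined. *)
Lemma same_porbit_conj g h :
  (forall x, porbit g x = porbit h x) -> exists c, h = (g ^ c)%g.
Proof.
move=> gh; pose r := porbit_rep g.
have rr x : r (r x) = r x.
  apply/eqP; rewrite porbit_rep_eq; rewrite eq_porbit_mem; apply: porbit_repP.
pose c x := iter (index x (traject g (r x) #|porbit g (r x)|)) h (r x).
have n_gt0 x : (0 < #|porbit g x|)%N by rewrite lt0n card_porbit_neq0.
have cE x i : c (iter i g (r x)) = iter i h (r x).
  have ri : r (iter i g (r x)) = r x.
    rewrite -[RHS]rr; apply/eqP; rewrite porbit_rep_eq -permX eq_porbit_mem.
    exact: mem_porbit.
  rewrite /c ri -(iter_porbit_mod g) -[in RHS](iter_porbit_mod h) -gh.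
  have lt := ltn_pmod i (n_gt0 (r x)).
  rewrite -{1}(nth_traject g lt (r x)) index_uniq ?size_traject //.
  exact: uniq_traject_porbit.
have rE x : exists i, x = iter i g (r x).
  have := porbit_repP g x; rewrite porbit_sym => /porbitP [i Ei].
  by exists i; rewrite -permX.
have cI : injective c.
  move=> x y; have [i Ex] := rE x; have [j Ey] := rE y.
  rewrite {1}Ex {1}Ey !cE => Eij.
  have Er : r x = r y.
    rewrite -(rr x) -(rr y); apply/eqP; rewrite porbit_rep_eq !gh.
    rewrite -(porbit_perm h i) -(porbit_perm h j (r y)).
    by rewrite !permX Eij.
  rewrite Ex Ey -Er; move: Eij; rewrite -Er => Eij; move: Eij.
  rewrite -(iter_porbit_mod h _ i) -(iter_porbit_mod h _ j).
  rewrite -(iter_porbit_mod g _ i) -(iter_porbit_mod g _ j) -gh.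
  have lti := ltn_pmod i (n_gt0 (r x)); have ltj := ltn_pmod j (n_gt0 (r x)).
  rewrite -(nth_traject h lti (r x)) -(nth_traject h ltj (r x)).
  move/eqP; rewrite nth_uniq ?size_traject //; first by move/eqP->.
  by rewrite gh uniq_traject_porbit.
exists (perm cI); apply/permP=> y.
have -> : y = perm cI ((perm cI)^-1%g y) by rewrite permKV.
set x := ((perm cI)^-1)%g y; rewrite conjgE !permM permK !permE.
have [i ->] := rE x; rewrite cE -iterS -cE.
by congr c.
Qed.
End SameOrbits.

(** * Class functions are determined by sums over word stabilizers *)

Section Separation.
Variable m : nat.
Local Notation G := [set: 'S_m].
Implicit Types (g h : 'S_m) (phi : 'CF(G)).

Lemma word_stab_porbit_rep g h :
  reflect (forall x, porbit g (h x) = porbit g x) (h \in word_stab (porbit_rep g)).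
Proof.
apply: (iffP (word_stabP _ _)) => H x; apply/eqP.
  by rewrite -porbit_rep_eq H.
by rewrite porbit_rep_eq H.
Qed.

(** Each orbit of [h] lies inside an orbit of [g], so either the refinement is strict or the orbits
    coincide. *)
Lemma word_stab_porbits g h : h \in word_stab (porbit_rep g) ->
  (#|porbits g| < #|porbits h|)%N \/ forall x, porbit g x = porbit h x.
Proof.
move/word_stab_porbit_rep=> gh.
have sub x y : y \in porbit h x -> porbit g y = porbit g x.
  move/porbitP=> [i ->]; elim: i => [|i IHi]; first by rewrite perm1.
  by rewrite expgSr permM gh.
pose f (B : {set 'I_m}) := if [pick y in B] is Some y then porbit g y else set0.
have fE x : f (porbit h x) = porbit g x.
  rewrite /f; case: pickP => [y /sub // | /(_ x)]; by rewrite porbit_id.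
have fim : f @: porbits h = porbits g.
  rewrite /porbits -imset_comp; apply: eq_imset => x; exact: fE.
have le : (#|porbits g| <= #|porbits h|)%N by rewrite -fim leq_imset_card.
have [|ge] := ltnP #|porbits g| #|porbits h|; [by left | right].
have /imset_injP fI : #|f @: porbits h| == #|porbits h| by rewrite fim eqn_leq le.
move=> x; apply/setP=> y; rewrite -!eq_porbit_mem; apply/eqP/eqP => [E | E].
  by apply: fI; rewrite ?imset_f // !fE.
by apply: sub; rewrite -eq_porbit_mem E.
Qed.

(* Taking for w the word of the orbits of g, a permutation in word_stab w
   either has the same orbits as g, hence is conjugate to g, or has more
   orbits than g. *)
Lemma word_stab_separation phi :
    (forall w : 'I_m -> 'I_m, \sum_(s in word_stab w) phi s = 0) -> phi = 0.
Proof.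
move=> phi0; apply/cfunP=> g; rewrite cfunE.
have [k] := ubnP (m - #|porbits g|); elim: k g => // k IHk g lt.
have porb_le h : (#|porbits h| <= m)%N.
  by rewrite -[X in (_ <= X)%N](card_ord m) leq_imset_card.
have := phi0 (porbit_rep g); pose same h := [forall x, porbit g x == porbit h x].
rewrite (bigID same) /= [X in _ + X]big1 ?addr0 => [|h /andP[sh nsame]]; last first.
  have [lt' | E] := word_stab_porbits sh; last first.
    by case/negP: nsame; apply/forallP=> x; rewrite E.
  by apply: IHk; have := porb_le h; lia.
rewrite (eq_bigr (fun=> phi g)) => [|h /andP[_ /forallP E]]; last first.
  have [c ->] : exists c, h = (g ^ c)%g.
    by apply: same_porbit_conj => x; apply/eqP.
  by rewrite cfunJ ?inE.
rewrite sumr_const => /eqP; rewrite mulrn_eq0 => /orP[/eqP/card0_eq/(_ g)|/eqP //].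
rewrite unfold_in /= => /negP[]; apply/andP; split; last by apply/forallP.
apply/word_stab_porbit_rep => x; apply/eqP.
by rewrite eq_porbit_mem (mem_porbit g 1).
Qed.
End Separation.

Section Completeness.
Variable m : nat.
Local Notation G := [set: 'S_m].

Lemma word_sort (w : 'I_m -> 'I_m) : exists (mu : seq nat) (w0 : {ffun 'I_m -> 'I_m}),
  [/\ is_partition m mu, size mu = m, content w0 =1 (fun j => nth 0%N mu j)
    & word_stab w0 = word_stab w].
Proof.
pose ord (i j : 'I_m) := geq (content w i) (content w j).
pose s := sort ord (enum 'I_m).
have ss : size s = m by rewrite size_sort size_enum_ord.
have us : uniq s by rewrite sort_uniq enum_uniq.
have ms i : i \in s by rewrite mem_sort mem_enum.
have w0P k : (index (w k) s < m)%N by rewrite -{2}ss index_mem.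
exists (map (content w) s), [ffun k => Ordinal (w0P k)]; split.
- apply/andP; split; first by rewrite sorted_map; apply: sort_sorted => i j;
    exact: leq_total.
  by rewrite sumnE big_map (perm_big _ (permEl (perm_sort _ _))) big_enum sum_content.
- by rewrite size_map.
- move=> j; rewrite (nth_map j) ?ss //; apply: eq_card => k.
  rewrite !inE ffunE -val_eqE /=; apply/eqP/eqP => [<- | ->];
    first by rewrite nth_index.
  by rewrite index_uniq ?ss.
apply/setP=> g; apply/word_stabP/word_stabP => H k.
  have /(congr1 val) /= := H k; rewrite !ffunE /= => E.
  by rewrite -(nth_index k (ms (w (g k)))) E nth_index.
by rewrite !ffunE; apply: val_inj; rewrite /= H.
Qed.

(** Padding the partitions of [m] to [m] parts, each at most [m], places them in a finite type where
    they can be counted. *)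
Let pseq (f : {ffun 'I_m -> 'I_m.+1}) : seq nat :=
  mkseq (fun i => oapp (fun j => f j : nat) 0%N (insub i)) m.

Let pseqP mu : is_partition m mu -> size mu = m -> exists f, pseq f = mu.
Proof.
move=> /andP[_ /eqP Es] sm; exists [ffun i : 'I_m => inord (nth 0%N mu i)].
have mub i : (nth 0%N mu i < m.+1)%N.
  by rewrite ltnS -Es; apply: leq_trans (psum_le_sumn mu i.+1);
    rewrite psumS leq_addl.
apply: (@eq_from_nth _ 0%N); rewrite size_mkseq ?sm // => i im.
by rewrite nth_mkseq // insubT /= ffunE inordK.
Qed.

Let pseq_inj : injective pseq.
Proof.
move=> f f' E; apply/ffunP=> i; apply: val_inj.
have := congr1 (fun s => nth 0%N s i) E.
by rewrite /pseq !nth_mkseq // !valK.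
Qed.

Lemma psi_separation (phi : 'CF(G)) :
    (forall f, is_partition m (pseq f) ->
      '[phi, psi m (fun j : 'I_m => nth 0%N (pseq f) j)] = 0) -> phi = 0.
Proof.
move=> phi0; apply: word_stab_separation => w.
have [mu [w0 [pmu smu w0mu <-]]] := word_sort w.
have [f Ef] := pseqP pmu smu; have := phi0 f; rewrite Ef => /(_ pmu) /eqP.
rewrite (cfdot_psi _ w0mu) mulf_eq0 invr_eq0.
by rewrite (negPf (neq0CG (word_stab_group w0))) => /eqP.
Qed.

(* There are at most as many permutation characters psi as partitions, they span
   the class functions, and the Specht characters are distinct. *)
Lemma irr_specht (i : Iirr G) :
  exists mu, is_partition m mu /\ 'chi_i = specht_char m mu.
Proof.
pose D := [set f | is_partition m (pseq f)].
suff /exists_inP [f] : [exists f in D, 'chi_i == specht_char m (pseq f)].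
  by rewrite inE => pf /eqP Ei; exists (pseq f).
apply: contraT; rewrite negb_exists_in => /forall_inP Ni.
pose idx f : Iirr G := odflt 0 [pick j | 'chi_j == specht_char m (pseq f)].
have idxE f : f \in D -> 'chi_(idx f) = specht_char m (pseq f).
  rewrite inE => pf; rewrite /idx; case: pickP => [j /eqP // | Nj].
  by have /irrP [j Ej] := specht_char_irr pf; have := Nj j; rewrite Ej eqxx.
have cardD : (#|D| < Nirr G)%N.
  have idxI : {in D &, injective idx}.
    move=> f f' fD f'D E; have := idxE f fD; rewrite E idxE // => /esym Esp.
    move: fD f'D; rewrite !inE => pf pf'; apply: pseq_inj.
    apply: (@eq_from_nth _ 0%N) => [|k _]; first by rewrite !size_mkseq.
    exact: specht_char_inj pf pf' Esp k.
  rewrite -(card_in_imset idxI) -[X in (_ < X)%N]card_ord -cardsT.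
  apply: proper_card; rewrite properE subsetT; apply/subsetPn; exists i;
    rewrite ?inE //.
  by apply/imsetP=> -[f fD Ei]; have := Ni f fD; rewrite Ei idxE ?eqxx.
(* With fewer partitions than irreducible characters, the rows of [A] satisfy a nontrivial relation.
   It defines a nonzero class function orthogonal to every [psi] of a partition, against
   [psi_separation]. *)
pose A : 'M[algC]_(Nirr G, #|D|) :=
  \matrix_(j, k) '['chi_j, psi m (fun j : 'I_m => nth 0%N (pseq (enum_val k)) j)].
have nzK : kermx A != 0.
  by rewrite -mxrank_eq0 mxrank_ker subn_eq0 -ltnNge (leq_ltn_trans (rank_leq_col A)).
pose x := nz_row (kermx A); have xA : x *m A = 0 by apply/sub_kermxP/nz_row_sub.
have nzx : x != 0 by rewrite nz_row_eq0.
pose phi := \sum_j x 0 j *: 'chi[G]_j.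
have phi0 : phi = 0.
  apply: psi_separation => f pf; have fD : f \in D by rewrite inE.
  have := congr1 (fun M : 'rV_#|D| => M 0 (enum_rank_in fD f)) xA;
    rewrite !mxE => <-.
  rewrite cfdot_suml; apply: eq_bigr => j _.
  by rewrite cfdotZl mxE enum_rankK_in.
case/negP: nzx; apply/eqP/rowP=> j; rewrite mxE.
have := cfdot0l 'chi[G]_j; rewrite -phi0 cfdot_suml (bigD1 j) //= big1 => [|k nk].
  by rewrite addr0 cfdotZl cfdot_irr eqxx mulr1.
by rewrite cfdotZl cfdot_irr (negPf nk) mulr0.
Qed.
End Completeness.

(** * Transferring multiplicities *)

Section SpechtIndex.
Variable m : nat.
Local Notation G := [set: 'S_m].

Definition specht_idx (mu : seq nat) : Iirr G :=
  odflt 0 [pick i | 'chi_i == specht_char m mu].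

Lemma specht_idxE mu : is_partition m mu ->
  'chi_(specht_idx mu) = specht_char m mu.
Proof.
move=> pmu; rewrite /specht_idx; case: pickP => [j /eqP // | Nj].
by have /irrP [j Ej] := specht_char_irr pmu; have := Nj j; rewrite Ej eqxx.
Qed.

Lemma cfdot_psi_irr n (theta : 'CF(G)) (g : 'I_n -> nat) :
  '[theta, psi m g] = \sum_i '[theta, 'chi_i] * '['chi_i, psi m g].
Proof.
by rewrite cfdot_sum_irr; apply: eq_bigr => i _; rewrite -cfdotC.
Qed.

Local Open Scope nat_scope.

Lemma part_length_le mu q : is_partition m mu ->
  (part_length mu <= q) = (nth 0 mu q == 0).
Proof. by case/andP=> smu _; rewrite leqNgt -part_length_nth // -eqn0Ngt. Qed.

(** Dominance up to [q] already bounds the length of [nu]. The sum of the partial sums turns strict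
    dominance into a numerical measure for the inductions below. *)
Lemma specht_psi_part q mu nu : is_partition m mu -> is_partition m nu ->
    part_length mu <= q ->
    ('[specht_char m nu, psi m (fun j : 'I_q => nth 0 mu j)] != 0)%R ->
  [/\ part_length nu <= q, forall k, k <= q -> psum mu k <= psum nu k
    & specht_char m nu = specht_char m mu \/
      \sum_(k < q.+1) psum mu k < \sum_(k < q.+1) psum nu k].
Proof.
move=> pmu pnu lmu nz.
have dom k : k <= q -> psum mu k <= psum nu k.
  move=> kq; have := specht_psi_dominance k pnu nz.
  by rewrite -(big_ord_widen q (nth 0 mu)).
have [smu /eqP Emu] := andP pmu; have [snu /eqP Enu] := andP pnu.
have lnu : part_length nu <= q.
  rewrite part_length_le // -leqn0 -(leq_add2l (psum nu q)) addn0 -psumS.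
  apply: leq_trans (dom q _) => //.
  by rewrite (psum_part_length smu lmu) Emu -Enu psum_le_sumn.
split=> //.
have /leqif_sum : forall k : 'I_q.+1, true ->
    psum mu k <= psum nu k ?= iff (psum mu k == psum nu k).
  by move=> k _; split=> //; rewrite dom // -ltnS.
move/leqifP; case: ifP => [/forallP H _ | _]; last by right.
left; apply: specht_char_eq => // i.
have H' k : k <= q -> psum mu k = psum nu k.
  by move=> kq; apply/eqP; have := H (Ordinal (kq : k < q.+1)).
have [iq | qi] := ltnP i q.
  by have := H' i.+1 iq; rewrite !psumS H' ?(ltnW iq) // => /addnI.
move: lmu lnu; rewrite !part_length_le // => /eqP m0 /eqP n0.
have := part_nth smu qi; have := part_nth snu qi; rewrite m0 n0 !leqn0.
by move=> /eqP-> /eqP->.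
Qed.
End SpechtIndex.

Section ShiftTransfer.
Local Open Scope nat_scope.
Variables (m m' q s : nat).
Hypothesis Em : m' = m + q * s.
Variables (theta : 'CF([set: 'S_m])) (theta' : 'CF([set: 'S_m'])).
Hypothesis theta_psi : forall g : 'I_q -> nat,
  '[theta, psi m g]%R = '[theta', psi m' (fun j => (g j + s)%N)]%R.
Hypothesis theta_psi0 : forall (g : 'I_q -> nat) j, g j < s ->
  ('[theta', psi m' g] = 0)%R.

(** Expand the vanishing pairing of [theta'] with the [psi] of [mu]: the term of [mu] has
    coefficient 1, and the other partitions that occur strictly dominate [mu] and still have a part
    below [s], so induction removes them. *)
Lemma cfdot_specht_unshifted mu j : is_partition m' mu -> part_length mu <= q ->
  j < q -> nth 0 mu j < s -> ('[theta', specht_char m' mu] = 0)%R.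
Proof.
move=> pmu lmu jq mus; pose stat (la : seq nat) := \sum_(k < q.+1) psum la k.
have [N] := ubnP (q.+1 * m' - stat mu).
elim: N mu j pmu lmu jq mus => // N IH mu j pmu lmu jq mus ltN.
have /fin_all_exists [sh shP] := @irr_specht m'.
pose g (j : 'I_q) := nth 0 mu j.
have := theta_psi0 (g := g) (j := Ordinal jq) mus.
rewrite cfdot_psi_irr (bigD1 (specht_idx m' mu)) //= specht_idxE //.
rewrite specht_psi_diag // mulr1 big1 ?addr0 // => i ni.
have [psh Ei] := shP i.
have [-> | nz] := eqVneq ('['chi_i, psi m' g])%R 0%R; first by rewrite mulr0.
rewrite Ei in nz; have [lsh dom Esh] := specht_psi_part pmu psh lmu nz.
case: Esh => [Esh | lt].
  case/eqP: ni; apply: irr_inj; rewrite specht_idxE // -Esh; exact: Ei.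
have bound : stat (sh i) <= q.+1 * m'.
  rewrite -[q.+1 in X in _ <= X]card_ord -sum_nat_const; apply: leq_sum => k _.
  by case/andP: psh => _ /eqP <-; apply: psum_le_sumn.
(* Here [q'] is the index of the last of the [q] parts. The totals agree and [sh i] dominates [mu],
   so its last part is at most that of [mu], hence below [s]. *)
have [q' Eq] : exists q', q = q'.+1 by exists q.-1; lia.
rewrite Ei (IH (sh i) q') ?mul0r //; first by rewrite Eq.
  have [smu /eqP Emu] := andP pmu; have [ssh /eqP Eshi] := andP psh.
  have := dom q' _; rewrite Eq leqnSn => /(_ isT).
  have : psum mu q = psum (sh i) q by rewrite !psum_part_length // Emu Eshi.
  rewrite Eq !psumS; have : nth 0 mu q' <= nth 0 mu j by apply: part_nth => //; lia.
  lia.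
move: lt ltN bound; rewrite -/(stat mu) -/(stat (sh i)); lia.
Qed.

Lemma unshift_partition nu : is_partition m' nu -> part_length nu <= q ->
    (forall j, j < q -> s <= nth 0 nu j) ->
  exists mu, [/\ is_partition m mu, part_length mu <= q
                & specht_char m' (add_const mu s q) = specht_char m' nu].
Proof.
move=> pnu lnu snu; have [ss /eqP Es] := andP pnu.
pose mu := mkseq (fun i => nth 0 nu i - s) q.
have E i : nth 0 (add_const mu s q) i = nth 0 nu i.
  rewrite nth_add_const; case: ltnP => iq; first by rewrite nth_mkseq // subnK ?snu.
  move: lnu; rewrite (part_length_le _ pnu) => /eqP n0.
  by have := part_nth ss iq; rewrite n0 leqn0 => /eqP.
have pmu : sorted geq mu.
  have geqT : transitive geq by move=> x y z /= yx zy; apply: leq_trans zy yx.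
  apply/(sortedP 0) => i; rewrite size_mkseq => i1.
  by rewrite !nth_mkseq ?(ltnW i1) //= leq_sub2r // part_nth.
have lmu : part_length mu <= q.
  by apply: leq_trans (part_length_size _) _; rewrite size_mkseq.
have smu : is_partition (sumn mu) mu by rewrite /is_partition pmu eqxx.
have Esum : sumn mu = m.
  have := is_partition_add_const s smu lmu => /andP[sA /eqP EA].
  apply: (@addIn (q * s)); rewrite -Em -Es -EA.
  rewrite -(psum_part_length sA (part_length_add_const _ _ _)) -(psum_part_length ss lnu).
  by apply: eq_bigr => i _; rewrite E.
exists mu; split=> //; first by rewrite -{1}Esum.
apply: specht_char_eq => //; rewrite Em -Esum.
by have := is_partition_add_const s smu lmu => /andP[_ /eqP].
Qed.

(* Expand both sides of theta_psi at g = mu: by unitriangularity the terms other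
   than those of mu come from larger partitions, where induction applies. *)
Lemma cfdot_specht_shift mu : is_partition m mu -> part_length mu <= q ->
  '[theta, specht_char m mu]%R = '[theta', specht_char m' (add_const mu s q)]%R.
Proof.
move=> pmu lmu; pose stat (la : seq nat) := \sum_(k < q.+1) psum la k.
have [N] := ubnP (q.+1 * m - stat mu); elim: N mu pmu lmu => // N IH mu pmu lmu ltN.
have /fin_all_exists [sh shP] := @irr_specht m.
have /fin_all_exists [sh' shP'] := @irr_specht m'.
have pS la : is_partition m la -> part_length la <= q ->
    is_partition m' (add_const la s q).
  by move=> pla lla; rewrite Em; apply: is_partition_add_const.
have lS la : part_length (add_const la s q) <= q by apply: part_length_add_const.
pose g (j : 'I_q) := nth 0 mu j.
have Eg (la : seq nat) : psi m' (fun j : 'I_q => nth 0 la j + s) =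
    psi m' (fun j : 'I_q => nth 0 (add_const la s q) j).
  by apply: eq_psi => j; rewrite nth_add_const ltn_ord.
pose i0 := specht_idx m mu; pose i0' := specht_idx m' (add_const mu s q).
have := theta_psi g; rewrite Eg !cfdot_psi_irr.
rewrite [LHS](bigD1 i0) //= [RHS](bigD1 i0') //= !specht_idxE ?pS //.
rewrite !specht_psi_diag ?pS // !mulr1.
(* The set [A] indexes the partitions other than [mu] with at most [q] parts, and [f] shifts them.
   The two expansions reduce to sums over [A] and over its image. *)
pose A := [set i | (i != i0) && (part_length (sh i) <= q)].
pose f i := specht_idx m' (add_const (sh i) s q).
have fE i : i \in A -> 'chi_(f i) = specht_char m' (add_const (sh i) s q).
  by rewrite inE => /andP[_ li]; have [pi _] := shP i; rewrite specht_idxE ?pS.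
have nth_inj la nu : is_partition m la -> is_partition m nu ->
    part_length la <= q -> part_length nu <= q ->
    specht_char m' (add_const la s q) = specht_char m' (add_const nu s q) ->
    specht_char m la = specht_char m nu.
  move=> pla pnu lla lnu E; apply: specht_char_eq;
    first by case/andP: pla => _ /eqP.
  move=> i; have := specht_char_inj (pS _ pla lla) (pS _ pnu lnu) E i.
  rewrite !nth_add_const; case: ltnP => [_ /addIn // | qi _].
  move: lla lnu;
    rewrite (part_length_le _ pla) (part_length_le _ pnu) => /eqP l0 /eqP n0.
  have [sla _] := andP pla; have [snu _] := andP pnu.
  have := part_nth sla qi; have := part_nth snu qi; rewrite l0 n0 !leqn0.
  by move=> /eqP-> /eqP->.
have fI : {in A &, injective f}.
  move=> i j iA jA Eij; have := fE i iA; rewrite Eij fE // => Esp.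
  move: iA jA; rewrite !inE => /andP[_ li] /andP[_ lj].
  have [pi Ei] := shP i; have [pj Ej] := shP j.
  by apply: irr_inj; rewrite Ei Ej; apply: nth_inj.
have -> : (\sum_(i < Nirr [set: 'S_m] | i != i0)
      '[theta, 'chi_i] * '['chi_i, psi m g])%R =
    (\sum_(i in A) '[theta, 'chi_i] * '['chi_i, psi m g])%R.
  rewrite [LHS](bigID (fun i => part_length (sh i) <= q)) /= [X in (_ + X)%R]big1 ?addr0.
    by apply: eq_bigl => i; rewrite inE.
  move=> i /andP[_ nl]; have [pi Ei] := shP i.
  have [-> | nz] := eqVneq ('['chi_i, psi m g])%R 0%R; first by rewrite mulr0.
  by rewrite Ei in nz; have [lsh _ _] := specht_psi_part pmu pi lmu nz;
    rewrite lsh in nl.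
have -> : (\sum_(i < Nirr [set: 'S_m'] | i != i0') '[theta', 'chi_i] *
      '['chi_i, psi m' (fun j : 'I_q => nth 0 (add_const mu s q) j)])%R =
    (\sum_(i in f @: A) '[theta', 'chi_i] *
      '['chi_i, psi m' (fun j : 'I_q => nth 0 (add_const mu s q) j)])%R.
  rewrite [LHS](bigID (fun i => i \in f @: A)) /= [X in (_ + X)%R]big1 ?addr0.
    apply: eq_bigl => i; rewrite andbC; case: imsetP => //= -[k kA ->].
    apply/eqP=> Ek; have := fE k kA; rewrite Ek specht_idxE ?pS // => Esp.
    move: kA; rewrite inE => /andP[/eqP nk lk]; have [pk Ek'] := shP k.
    by case: nk; apply: irr_inj; rewrite Ek' specht_idxE //; apply: nth_inj.
  move=> i /andP[ni nA]; have [pi Ei] := shP' i.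
  have [-> | nz] :=
      eqVneq ('['chi_i, psi m' (fun j : 'I_q => nth 0 (add_const mu s q) j)])%R 0%R.
    by rewrite mulr0.
  rewrite Ei in nz; have [lsh _ _] := specht_psi_part (pS _ pmu lmu) pi (lS _) nz.
  (* A part below [s] kills the term by [cfdot_specht_unshifted]; otherwise the partition is a
     shift, and [i] would lie in the image of [A]. *)
  have [/existsP [j jlt] | /existsPn Nj] :=
      boolP [exists j : 'I_q, nth 0 (sh' i) j < s].
    by rewrite Ei (cfdot_specht_unshifted pi lsh (ltn_ord j) jlt) mul0r.
  have [j jq | nu [pnu lnu Enu]] := unshift_partition pi lsh.
    by rewrite leqNgt; have := Nj (Ordinal jq).
  have Es := specht_idxE pnu; case/negP: nA; set k := specht_idx m nu in Es.
  have [pk Ek] := shP k.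
  have Enth : forall x, nth 0 (sh k) x = nth 0 nu x.
    by apply: specht_char_inj pk pnu _; rewrite -Ek.
  have lk : part_length (sh k) <= q.
    by rewrite (part_length_le _ pk) Enth -(part_length_le _ pnu).
  have Efk : f k = i.
    apply: irr_inj; rewrite specht_idxE ?pS // (add_const_eq _ _ Enth) Enu.
    exact/esym.
  apply/imsetP; exists k => //; rewrite inE lk andbT; apply: contraNneq ni => Ek0.
  apply/eqP; apply: irr_inj; rewrite -Efk specht_idxE ?pS // specht_idxE ?pS //.
  have Esp : specht_char m (sh k) = specht_char m mu by rewrite -Ek Ek0 specht_idxE.
  by rewrite (add_const_eq _ _ (specht_char_inj pk pmu Esp)).
rewrite big_imset //=.
suff -> : (\sum_(i in A) '[theta', 'chi_(f i)] *
      '['chi_(f i), psi m' (fun j : 'I_q => nth 0 (add_const mu s q) j)])%R =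
    (\sum_(i in A) '[theta, 'chi_i] * '['chi_i, psi m g])%R by move/addIr.
apply: eq_bigr => i iA; rewrite fE //; have [pi Ei] := shP i.
move: (iA); rewrite inE => /andP[ni li].
rewrite -Eg (specht_psi_addc pi li _ Em) Ei.
have [-> | nz] := eqVneq ('[specht_char m (sh i), psi m g])%R 0%R;
  first by rewrite !mulr0.
congr (_ * _)%R; apply/esym/IH => //.
have [_ _ [Esp | lt]] := specht_psi_part pmu pi lmu nz.
  by case/eqP: ni; apply: irr_inj; rewrite Ei specht_idxE.
have bound : stat (sh i) <= q.+1 * m.
  rewrite -[q.+1 in X in _ <= X]card_ord -sum_nat_const; apply: leq_sum => k _.
  by case/andP: pi => _ /eqP <-; apply: psum_le_sumn.
move: lt ltN bound; rewrite -/(stat mu) -/(stat (sh i)); lia.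
Qed.
End ShiftTransfer.

(** * Kronecker coefficients *)

Section RealCharacters.
Variable m : nat.
Local Notation G := [set: 'S_m].

(** A permutation and its inverse have the same orbits, hence are conjugate. *)
Lemma conj_specht la (s : 'S_m) : is_partition m la ->
  (specht_char m la s)^* = specht_char m la s.
Proof.
move=> pla; have /irrP [i ->] := specht_char_irr pla.
rewrite -char_inv ?irr_char //.
have [c ->] : exists c, (s^-1 = s ^ c)%g.
  by apply: same_porbit_conj => x; rewrite porbitV.
by rewrite cfunJ ?inE.
Qed.

Lemma cfdotMC (a b c : 'CF(G)) : (forall s, (b s)^* = b s) ->
  (forall s, (c s)^* = c s) -> '[a * b, c] = '[a * c, b].
Proof.
move=> rb rc; rewrite !cfdotE; congr (_ * _); apply: eq_bigr => s _.
by rewrite !cfunE rb rc mulrAC.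
Qed.
End RealCharacters.

(** * Products of permutation characters and contingency matrices *)

Section Margins.
Local Open Scope nat_scope.
Variables (q r : nat).

Definition row_margin (c : 'I_(q * r) -> nat) (i : 'I_q) := \sum_j c (mxvec_index i j).
Definition col_margin (c : 'I_(q * r) -> nat) (j : 'I_r) := \sum_i c (mxvec_index i j).

Lemma content_row_margin m (u : 'I_m -> 'I_q) (v : 'I_m -> 'I_r) i :
  content u i = row_margin (content (fun k => mxvec_index (u k) (v k))) i.
Proof.
rewrite /content -sum1_card (partition_big v predT) //=.
apply: eq_bigr => j _; rewrite -sum1_card; apply: eq_bigl => k; rewrite !inE.
by apply/andP/eqP => [[/eqP<- /eqP<-] // | /mxvec_index_inj [-> ->]].
Qed.

Lemma content_col_margin m (u : 'I_m -> 'I_q) (v : 'I_m -> 'I_r) j :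
  content v j = col_margin (content (fun k => mxvec_index (u k) (v k))) j.
Proof.
rewrite /content -sum1_card (partition_big u predT) //=.
apply: eq_bigr => i _; rewrite -sum1_card; apply: eq_bigl => k; rewrite !inE.
by apply/andP/eqP => [[/eqP<- /eqP<-] // | /mxvec_index_inj [-> ->]].
Qed.

Definition has_margins B (a : 'I_q -> nat) (b : 'I_r -> nat)
    (c : {ffun 'I_(q * r) -> 'I_B}) :=
  [forall i, row_margin (fun x => c x) i == a i] &&
  [forall j, col_margin (fun x => c x) j == b j].

(** A pair of words is a word in the product alphabet, and its content is a matrix with margins [a]
    and [b]. Contents never exceed [m], so the bound [B] gives a finite index type without losing
    any. *)
Lemma psiM m B (a : 'I_q -> nat) (b : 'I_r -> nat) : m <= B ->
  (psi m a * psi m b =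
     \sum_(c : {ffun 'I_(q * r) -> 'I_B.+1} | has_margins a b c)
        psi m (fun x => c x))%R.
Proof.
move=> mB; apply/cfunP=> s; rewrite cfunE sum_cfunE !psiE -natrM -cardsX.
rewrite (eq_bigr (fun c : {ffun 'I_(q * r) -> 'I_B.+1} =>
  #|[set w in word_set m (fun x => c x) | s \in word_stab w]|%:R)%R) => [|c _]; last first.
  by rewrite psiE.
rewrite -natr_sum; congr (_%:R)%R.
pose F (x : {ffun 'I_m -> 'I_q} * {ffun 'I_m -> 'I_r}) :=
  [ffun k => mxvec_index (x.1 k) (x.2 k)] : {ffun 'I_m -> 'I_(q * r)}.
have FI : injective F.
  move=> [u v] [u' v'] /ffunP E; congr pair; apply/ffunP=> k;
    by have := E k; rewrite !ffunE /= => /mxvec_index_inj [].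
have [f fK Kf] := onT_bij (curry_mxvec_bij q r).
have Fsur w : exists x, F x = w.
  exists ([ffun k => (f (w k)).1], [ffun k => (f (w k)).2]); apply/ffunP=> k.
  by rewrite !ffunE /= -[RHS]Kf; case: (f _).
pose ct (w : {ffun 'I_m -> 'I_(q * r)}) : {ffun 'I_(q * r) -> 'I_B.+1} :=
  [ffun x => inord (content w x)].
have ctE w x : ct w x = content w x :> nat.
  rewrite ffunE inordK // ltnS (leq_trans _ mB) //.
  by rewrite -[X in (_ <= X)]card_ord max_card.
pose P := [set w : {ffun 'I_m -> 'I_(q * r)} |
             (s \in word_stab w) && has_margins a b (ct w)].
have -> : #|setX [set u in word_set m a | s \in word_stab u]
                 [set v in word_set m b | s \in word_stab v]| = #|P|.
  rewrite -(card_imset _ FI); apply: eq_card => w; have [[u v] <-] := Fsur w.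
  rewrite mem_imset // in_setX [X in X && _]in_set [X in _ && X]in_set [RHS]in_set.
  have -> : (s \in word_stab (F (u, v))) = (s \in word_stab u) && (s \in word_stab v).
    apply/word_stabP/andP => [H | [/word_stabP su /word_stabP sv] k].
      by split; apply/word_stabP=> k; have := H k;
        rewrite !ffunE => /mxvec_index_inj [].
    by rewrite !ffunE /= su sv.
  have Fct : content (F (u, v)) =1 content (fun k => mxvec_index (u k) (v k)).
    by apply: eq_content => k; rewrite ffunE.
  have -> : (u \in word_set m a) =
      [forall i, row_margin (fun x => ct (F (u, v)) x) i == a i].
    rewrite inE; apply: eq_forallb => i; rewrite (content_row_margin u v);
      congr (_ == _).
    by apply: eq_bigr => j _; rewrite ctE Fct.
  have -> : (v \in word_set m b) =
      [forall j, col_margin (fun x => ct (F (u, v)) x) j == b j].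
    rewrite inE; apply: eq_forallb => i; rewrite (content_col_margin u v);
      congr (_ == _).
    by apply: eq_bigr => j _; rewrite ctE Fct.
  by rewrite /has_margins andbACA andbC.
rewrite -sum1_card (partition_big ct (has_margins a b)) /= => [|w]; last first.
  by rewrite inE => /andP[].
apply: eq_bigr => c hc; rewrite -sum1_card; apply: eq_bigl => w.
rewrite [X in X && _]in_set [RHS]in_set.
have -> : (w \in word_set m (fun x => c x)) = (ct w == c).
  apply/word_setP/eqP => [H | <- j]; last by rewrite ctE.
  by apply/ffunP=> x; apply: val_inj; rewrite /= ctE H.
by case: eqP => [-> | _]; rewrite ?andbF // hc !andbT.
Qed.
End Margins.

(** * Shifting the three partitions *)

Section Main.
Local Open Scope nat_scope.
Variables (m q r t : nat) (la : seq nat).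
Hypotheses (pla : is_partition m la) (lla : part_length la <= q * r).
Variable m' : nat.
Hypothesis Em : m' = m + q * r * t.
Local Notation la' := (add_const la t (q * r)).

Lemma cfdot_psiM n lb (a : 'I_q -> nat) (b : 'I_r -> nat) B : n <= B ->
  '[specht_char n lb * psi n a, psi n b]%R =
  (\sum_(c : {ffun 'I_(q * r) -> 'I_B.+1} | has_margins a b c)
     '[specht_char n lb, psi n (fun x => c x)])%R.
Proof.
move=> nB; rewrite -cfdot_sumr -(psiM a b nB) !cfdotE; congr (_ * _)%R.
apply: eq_bigr => s _; rewrite !cfunE rmorphM /= (conj_psi a) -mulrA. by [].
Qed.

(** Adding [t] to every entry matches the matrices on the left with those on the right whose entries
    are all at least [t]; the others contribute 0 by [specht_psi_addc0]. *)
Lemma cfdot_psiM_shift (a : 'I_q -> nat) (b : 'I_r -> nat) :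
  '[specht_char m la * psi m a, psi m b]%R =
  '[specht_char m' la' * psi m' (fun i => (a i + r * t)%N),
    psi m' (fun j => (b j + q * t)%N)]%R.
Proof.
have mm' : m <= m' by rewrite Em leq_addr.
(* The entry bounds [m'] and [m' + t] leave room for adding [t]. *)
rewrite (cfdot_psiM la a b mm') (cfdot_psiM _ _ _ (leq_addr t m')).
have rowD (c : 'I_(q * r) -> nat) i :
    row_margin (fun x => c x + t) i = row_margin c i + r * t.
  by rewrite /row_margin big_split /= sum_nat_const card_ord.
have colD (c : 'I_(q * r) -> nat) j :
    col_margin (fun x => c x + t) j = col_margin c j + q * t.
  by rewrite /col_margin big_split /= sum_nat_const card_ord.
pose h (c : {ffun 'I_(q * r) -> 'I_m'.+1}) : {ffun 'I_(q * r) -> 'I_(m' + t).+1} :=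
  [ffun x => inord (c x + t)].
pose h' (c : {ffun 'I_(q * r) -> 'I_(m' + t).+1}) : {ffun 'I_(q * r) -> 'I_m'.+1} :=
  [ffun x => inord (c x - t)].
have hE c x : h c x = c x + t :> nat.
  by rewrite ffunE inordK // ltnS leq_add2r; have := ltn_ord (c x); lia.
have h'E c x : h' c x = c x - t :> nat.
  by rewrite ffunE inordK // ltnS leq_subLR; have := ltn_ord (c x); lia.
rewrite [RHS](bigID (fun c : {ffun 'I_(q * r) -> 'I_(m' + t).+1} =>
                       [forall x, t <= c x])) /=.
rewrite [X in (_ + X)%R]big1 ?addr0 => [|c /andP[_ /forallPn [x]]]; last first.
  by rewrite -ltnNge => ctx; apply: (specht_psi_addc0 pla lla Em ctx).
rewrite [RHS](reindex_onto h h') => [|c /andP[_ /forallP ct]]; last first.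
  by apply/ffunP=> x; apply: val_inj; rewrite /= hE h'E subnK.
apply: eq_big => c; last first.
  move=> _; rewrite -(specht_psi_addc pla lla _ Em); congr '[_, _]%R.
  by apply: eq_psi => x; rewrite hE.
have -> : [forall x, t <= h c x] by apply/forallP=> x; rewrite hE leq_addl.
have -> : h' (h c) == c.
  by apply/eqP/ffunP=> x; apply: val_inj; rewrite /= h'E hE addnK.
rewrite !andbT; congr andb; apply: eq_forallb => i.
  rewrite -(eqn_add2r (r * t)) -rowD; congr (_ == _).
  by apply: eq_bigr => j _; rewrite hE.
rewrite -(eqn_add2r (q * t)) -colD; congr (_ == _).
by apply: eq_bigr => j _; rewrite hE.
Qed.

Lemma cfdot_psiM_row0 (a : 'I_q -> nat) (b : 'I_r -> nat) i : a i < r * t ->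
  ('[specht_char m' la' * psi m' a, psi m' b] = 0)%R.
Proof.
move=> ai; rewrite (cfdot_psiM _ _ _ (leqnn m')) big1 // =>
  c /andP[/forallP/(_ i)/eqP ci _].
have [/existsP [x ctx] | /existsPn Nx] := boolP [exists x, c x < t].
  exact: (specht_psi_addc0 pla lla Em ctx).
have : r * t <= row_margin (fun x => c x) i.
  rewrite -{1}[r]card_ord -sum_nat_const; apply: leq_sum => j _.
  by rewrite leqNgt Nx.
by rewrite ci leqNgt ai.
Qed.

Lemma cfdot_psiM_col0 (a : 'I_q -> nat) (b : 'I_r -> nat) j : b j < q * t ->
  ('[specht_char m' la' * psi m' a, psi m' b] = 0)%R.
Proof.
move=> bj; rewrite (cfdot_psiM _ _ _ (leqnn m')) big1 // =>
  c /andP[_ /forallP/(_ j)/eqP cj].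
have [/existsP [x ctx] | /existsPn Nx] := boolP [exists x, c x < t].
  exact: (specht_psi_addc0 pla lla Em ctx).
have : q * t <= col_margin (fun x => c x) j.
  rewrite -{1}[q]card_ord -sum_nat_const; apply: leq_sum => i _.
  by rewrite leqNgt Nx.
by rewrite cj leqNgt bj.
Qed.

(** The transfer is applied twice: first to the factor of [nu], with [psi m a] in place of the
    factor of [mu], then to that of [mu]. Since the characters are real, [cfdotMC] exchanges the two
    positions. *)
Lemma kronecker_shift mu nu :
    is_partition m mu -> is_partition m nu ->
    part_length mu <= q -> part_length nu <= r ->
  kronecker m la mu nu =
  kronecker m' la' (add_const mu (r * t) q) (add_const nu (q * t) r).
Proof.
move=> pmu pnu lmu lnu; rewrite /kronecker.
have Eq : m' = m + q * (r * t) by rewrite mulnA.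
have Er : m' = m + r * (q * t) by rewrite mulnA [r * q]mulnC.
have pmu' : is_partition m' (add_const mu (r * t) q).
  by rewrite Eq is_partition_add_const.
have pnu' : is_partition m' (add_const nu (q * t) r).
  by rewrite Er is_partition_add_const.
have step a : '[specht_char m la * psi m a, specht_char m nu]%R =
    '[specht_char m' la' * psi m' (fun i : 'I_q => (a i + r * t)%N),
      specht_char m' (add_const nu (q * t) r)]%R.
  apply: (cfdot_specht_shift Er) => // [b | b j bj]; first exact: cfdot_psiM_shift.
  exact: cfdot_psiM_col0 bj.
have step0 a (i : 'I_q) : a i < r * t ->
    ('[specht_char m' la' * psi m' a, specht_char m' (add_const nu (q * t) r)] = 0)%R.
  (* This is the transfer with [theta = 0], as [cfdot_psiM_row0] makes all the pairings on the
     shifted side vanish. *)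
  move=> ai; rewrite -(@cfdot_specht_shift m m' r (q * t) Er 0%R) ?cfdot0l //.
    by move=> b; rewrite cfdot0l (cfdot_psiM_row0 _ ai).
  by move=> b j bj; apply: cfdot_psiM_col0 bj.
rewrite (cfdotMC _ (fun s => conj_specht s pmu) (fun s => conj_specht s pnu)).
rewrite (cfdotMC _ (fun s => conj_specht s pmu') (fun s => conj_specht s pnu')).
apply: (cfdot_specht_shift Eq) => // [a | a i ai].
  rewrite (cfdotMC _ (fun s => conj_specht s pnu) (conj_psi a)) step.
  exact: cfdotMC (conj_psi _) (fun s => conj_specht s pnu').
rewrite (cfdotMC _ (fun s => conj_specht s pnu') (conj_psi a)).
exact: step0 ai.
Qed.
End Main.

Local Open Scope nat_scope.

Theorem theorem3p1 (m : nat) (la mu nu : seq nat)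
    (hla : is_partition m la) (hmu : is_partition m mu)
    (hnu : is_partition m nu)
    (p q r : nat) (p_gt0 : 0 < p) (q_gt0 : 0 < q) (r_gt0 : 0 < r)
    (hp : part_length la <= p) (hq : part_length mu <= q)
    (hr : part_length nu <= r) (hpqr : p = q * r)
    (t : nat) (t_gt0 : 0 < t) :
  kronecker m la mu nu =
  kronecker (m + p * t)
    (add_const la t p) (add_const mu (r * t) q) (add_const nu (q * t) r).
Proof.
move: hp; rewrite hpqr => hp.
exact: kronecker_shift.
Qed.
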